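(* Let $n,m\ge 1$ be integers and let $X=(X_{i_1,i_2})_{(i_1,i_2)\in[n]\times[m]}$ and $Y=(Y_{i_1,i_2})_{(i_1,i_2)\in[n]\times[m]}$ be two (jointly) Gaussian random matrices with $\mathbf{E}(X_{i_1,i_2})=\mathbf{E}(Y_{i_1,i_2})$ for every $(i_1,i_2)\in[n]\times[m]$. Define $\gamma^X_{i_1,i_2;j_1,j_2}:=\mathbf{E}((X_{i_1,i_2}-X_{j_1,j_2})^2)$, $\gamma^Y_{i_1,i_2;j_1,j_2}:=\mathbf{E}((Y_{i_1,i_2}-Y_{j_1,j_2})^2)$ and $$\gamma:=\max_{(i_1,i_2),(j_1,j_2)\in[n]\times[m]}\bigl|\gamma^X_{i_1,i_2;j_1,j_2}-\gamma^Y_{i_1,i_2;j_1,j_2}\bigr|.$$ Then, for all $k\in[m]$, $$\Bigl|\mathbf{E}\Bigl(\min_{i_1\in[n]}\sum_{h=m-k+1}^m X_{i_1,(h)}\Bigr)-\mathbf{E}\Bigl(\min_{i_1\in[n]}\sum_{h=m-k+1}^m Y_{i_1,(h)}\Bigr)\Bigr|\le\sqrt{\gamma k}\cdot\Bigl[\sqrt{k\Bigl(1-\frac1n\Bigr)\Bigl(2-\frac1m\Bigr)\log n}+\sqrt{\Bigl(1-\frac km\Bigr)\log\binom mk}\Bigr].$$ Moreover, if for all $(i_1,i_2),(j_1,j_2)\in[n]\times[m]$ one has $\gamma^X_{i_1,i_2;j_1,j_2}\le\gamma^Y_{i_1,i_2;j_1,j_2}$ whenever $i_1=j_1$ and $\gamma^X_{i_1,i_2;j_1,j_2}\ge\gamma^Y_{i_1,i_2;j_1,j_2}$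 whenever $i_1\ne j_1$, then for all $k\in[m]$ $$\mathbf{E}\Bigl(\min_{i_1\in[n]}\sum_{h=m-k+1}^m X_{i_1,(h)}\Bigr)\le\mathbf{E}\Bigl(\min_{i_1\in[n]}\sum_{h=m-k+1}^m Y_{i_1,(h)}\Bigr).$$
   Context: For $r\in\mathbb{N}$, $[r]=\{1,\dots,r\}$. For $z\in\mathbb{R}^d$, $z_{(1)}\le z_{(2)}\le\dots\le z_{(d)}$ denote the order statistics of its components (in increasing order). For an $n\times m$ matrix $z$, $z_{i_1,(h)}$ denotes the $h$-th order statistic (in increasing order) of the $i_1$-th row $(z_{i_1,1},\dots,z_{i_1,m})$. A Gaussian random matrix is one whose entries are jointly Gaussian; no centering is assumed. *)

(* Defs.v *)
From HB Require Import structures.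
From mathcomp Require Import all_boot all_order all_algebra.
From mathcomp Require Import all_classical all_reals all_analysis.

Set Implicit Arguments.
Unset Strict Implicit.
Unset Printing Implicit Defensive.

Import Order.TTheory GRing.Theory Num.Theory.
Import numFieldNormedType.Exports.

Local Open Scope classical_set_scope.
Local Open Scope ring_scope.

(* [normal_prob mu 0] is the uniform law on [0, 1], hence the explicit Dirac
   mass for a zero standard deviation. *)
Definition gaussian_law (R : realType) (mu sigma : R) (A : set R) : \bar R :=
  if sigma == 0 then \d_mu A else normal_prob mu sigma A.

Definition is_gaussian (d : measure_display) (T : measurableType d)
    (R : realType) (P : probability T R) (Z : T -> R) : Prop :=
  exists mu sigma : R, 0 <= sigma /\
    forall A : set R, measurable A -> P (Z @^-1` A) = gaussian_law mu sigma A.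

(* Joint Gaussianity, degenerate covariances and arbitrary means allowed:
   every linear combination of the entries is Gaussian. *)
Definition gaussian_matrix (d : measure_display) (T : measurableType d)
    (R : realType) (P : probability T R) (n m : nat)
    (X : 'I_n -> 'I_m -> {RV P >-> R}) : Prop :=
  forall a : 'M[R]_(n, m),
    is_gaussian P (fun t => \sum_(i < n) \sum_(j < m) a i j * X i j t).

(* [fine] loses nothing for Gaussian matrices: the expectation is finite. *)
Definition incr (d : measure_display) (T : measurableType d)
    (R : realType) (P : probability T R) (n m : nat)
    (X : 'I_n -> 'I_m -> {RV P >-> R})
    (i1 : 'I_n) (i2 : 'I_m) (j1 : 'I_n) (j2 : 'I_m) : R :=
  fine 'E_P[fun t => ((X i1 i2 t - X j1 j2 t) ^+ 2)%R]%E.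

(* The entries are nonnegative and the index set is nonempty when
   [0 < n] and [0 < m], so the neutral value 0 does not affect the maximum. *)
Definition incr_dist (d : measure_display) (T : measurableType d)
    (R : realType) (P : probability T R) (n m : nat)
    (X Y : 'I_n -> 'I_m -> {RV P >-> R}) : R :=
  \big[Num.max/0]_(i1 < n) \big[Num.max/0]_(i2 < m)
  \big[Num.max/0]_(j1 < n) \big[Num.max/0]_(j2 < m)
    `|incr X i1 i2 j1 j2 - incr Y i1 i2 j1 j2|.

(* [order_stat z h] is z_(h), with h counted from 1. *)
Definition order_stat (R : realType) (p : nat) (z : 'I_p -> R) (h : nat) : R :=
  nth 0 (sort <=%R [seq z j | j : 'I_p]) h.-1.

Definition min_over (R : realType) (n : nat) (n_gt0 : (0 < n)%N)
    (f : 'I_n -> R) : R :=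
  \big[Num.min/f (Ordinal n_gt0)]_(i < n) f i.

Definition min_top_sum (d : measure_display) (T : measurableType d)
    (R : realType) (P : probability T R) (n m : nat) (n_gt0 : (0 < n)%N)
    (k : nat) (X : 'I_n -> 'I_m -> {RV P >-> R}) (t : T) : R :=
  min_over n_gt0 (fun i1 : 'I_n =>
    \sum_(m - k + 1 <= h < m.+1) order_stat (fun i2 : 'I_m => X i1 i2 t) h).

(* Main.v *)
Require Import Defs.
From HB Require Import structures.
From mathcomp Require Import all_boot all_order all_algebra.
From mathcomp Require Import all_classical all_reals all_analysis.
From mathcomp Require Import measurable_realfun ring lra.

Set Implicit Arguments.
Unset Strict Implicit.
Unset Printing Implicit Defensive.

Import Order.TTheory GRing.Theory Num.Theory.
Import numFieldNormedType.Exports.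

Local Open Scope classical_set_scope.
Local Open Scope ring_scope.

(** Write [f x] for the minimum over the rows [i] of the maximum, over the
   subsets [S] of size [k], of the sum of the [x (i, j)] with [j] in [S].

   The maximum and the minimum are first smoothed by log-sum-exp with inverse
   temperatures [b2] and [b1].  The resulting function [F] ([smooth_min_top])
   differs from [f] by at most [ln n / b1 + ln 'C(m, k) / b2].  Adding the same
   constant to all coordinates changes [F] by a constant, so the rows of its
   Hessian sum to zero and the Hessian, as a quadratic form, only sees squared
   differences of coordinates ([quadratic_increments]): this is why increments,
   and not covariances, control the comparison.  Off the diagonal the Hessian
   is nonnegative between different rows and nonpositive within a row.  The
   second sign is the negative correlation of a random [k]-subset with product
   weights ([avoid_negatively_correlated]), that is, the log-concavity of the
   elementary symmetric sums.  The signs give the monotone statement at once;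
   as all entries sum to zero they also turn the sum of their absolute values
   into a trace ([gibbs_hessian_offdiag]), which yields the constant
   [b1 k^2 (1 - 1/n) (2 - 1/m) + b2 k (1 - k/m)].  Optimising [b1] and [b2]
   gives the two square roots of the theorem.

   For the expectations ([gaussian_comparison]), let [x] and [y] be the centered
   families, [x'] and [y'] independent copies, and
   [G s t = E F (mu + sqrt s x + sqrt t y')].  Then [G (s + h) t - G s (t + h)]
   compares the effect of adding an independent [sqrt h x''] or [sqrt h y''] to
   one and the same random point.  A second-order expansion with cubic
   remainder, uniform in that point, bounds it by [h K + O (h sqrt h)] where
   [K] bounds the second-order term; [N] steps of length [1 / N] lead from [G 0 1]
   to [G 1 0].

   Besides vanishing means and finite third moments, the only property of
   Gaussian families used there is that [sqrt (s + h) x] and [sqrt s x + sqrt h x'] have the same law.  As laws of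
   linear combinations are known, this is a Cramer-Wold theorem
   ([law_unique]).  It is proved without Fourier inversion: the bounded
   functionals which can be inserted as a factor in all equalities of cosine
   averages form an algebra closed under bounded pointwise limits; it contains the
   sines, hence their polynomial images, hence by Newton iteration the square
   waves [sg (sin (a (v - c)))], hence for [a] tending to [0] the signs
   [sg (v - c)] and the indicators of boxes.  The cosine averages themselves are
   computed in dimension one from Gaussian integration by parts
   ([normal_stein], [normal_wave]). *)

(** * Integrals of real-valued functions *)

(** Statements are pointwise in the functions, so that expressions in random
   variables are handled without unfolding extended-real operations. *)
Section real_integrable.
Context d (T : measurableType d) (R : realType).
Variable P : {finite_measure set T -> \bar R}.
Implicit Types f g : T -> R.
Local Notation int f := (P.-integrable [set: T] (EFin \o f)).

Lemma rint_measurable f : int f -> measurable_fun [set: T] f.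
Proof. by move=> h; exact/measurable_EFinP/(measurable_int P). Qed.

Lemma rint_le f g : measurable_fun [set: T] f ->
  (forall x, `|f x| <= g x) -> int g -> int f.
Proof.
move=> mf fg ig; apply: (le_integrable measurableT _ _ ig).
  exact/measurable_EFinP.
by move=> x _; rewrite lee_fin (le_trans (fg x))// ler_norm.
Qed.

Lemma rint_cst k : int (fun _ => k).
Proof. exact: finite_measure_integrable_cst. Qed.

Lemma rint_bounded f k : measurable_fun [set: T] f ->
  (forall x, `|f x| <= k) -> int f.
Proof. by move=> mf fk; apply: rint_le mf fk _; exact: rint_cst. Qed.

Lemma rintD f g : int f -> int g -> int (fun x => f x + g x).
Proof. by move=> fi gi; exact: (integrableD measurableT fi gi). Qed.

Lemma rintN f : int f -> int (fun x => - f x).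
Proof. by move=> fi; exact: (integrableN fi). Qed.

Lemma rintB f g : int f -> int g -> int (fun x => f x - g x).
Proof. by move=> fi gi; apply: rintD => //; exact: rintN. Qed.

Lemma rintZ k f : int f -> int (fun x => k * f x).
Proof. by move=> fi; exact: (integrableZl measurableT k fi). Qed.

Lemma rint_norm f : int f -> int (fun x => `|f x|).
Proof. by move=> fi; exact: (integrable_abse fi). Qed.

Lemma rint_sum (I : Type) (r : seq I) (h : I -> T -> R) :
  (forall i, int (h i)) -> int (fun x => \sum_(i <- r) h i x).
Proof.
move=> hi; elim: r => [|i r IH].
  by under eq_fun do rewrite big_nil; exact: rint_cst.
by under eq_fun do rewrite big_cons; exact: rintD.
Qed.

Lemma RintD f g : int f -> int g ->
  \int[P]_x (f x + g x) = \int[P]_x f x + \int[P]_x g x.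
Proof. by move=> fi gi; rewrite RintegralD. Qed.

Lemma RintB f g : int f -> int g ->
  \int[P]_x (f x - g x) = \int[P]_x f x - \int[P]_x g x.
Proof. by move=> fi gi; rewrite RintegralB. Qed.

Lemma RintZ k f : int f -> \int[P]_x (k * f x) = k * \int[P]_x f x.
Proof. by move=> fi; rewrite RintegralZl. Qed.

Lemma Rint_sum (I : Type) (r : seq I) (h : I -> T -> R) :
  (forall i, int (h i)) ->
  \int[P]_x (\sum_(i <- r) h i x) = \sum_(i <- r) \int[P]_x h i x.
Proof.
move=> hi; elim: r => [|i r IH].
  rewrite big_nil; under eq_Rintegral do rewrite big_nil.
  by rewrite /Rintegral integral0.
rewrite big_cons -IH -RintD//; last exact: rint_sum.
by apply: eq_Rintegral => x _; rewrite big_cons.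
Qed.

Lemma Rint_le f g : int f -> int g -> (forall x, f x <= g x) ->
  \int[P]_x f x <= \int[P]_x g x.
Proof. by move=> fi gi fg; apply: le_Rintegral. Qed.

Lemma Rint_EFin f : int f -> (\int[P]_x (f x)%:E)%E = (\int[P]_x f x)%:E.
Proof. by move=> fi; rewrite /Rintegral fineK//; exact: integrable_fin_num. Qed.

Lemma bounded_cvg_Rintegral (f_ : nat -> T -> R) f (k : R) :
  (forall n, measurable_fun [set: T] (f_ n)) ->
  (forall n x, `|f_ n x| <= k) ->
  (forall x, f_ n x @[n --> \oo] --> f x) ->
  \int[P]_x f_ n x @[n --> \oo] --> \int[P]_x f x.
Proof.
move=> mf fk ff.
have mf' : measurable_fun [set: T] f by exact: (measurable_fun_cvg mf).
have [] := @dominated_convergence _ _ _ P setT measurableT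
  (fun n => EFin \o f_ n) (EFin \o f) (EFin \o cst k).
- by move=> n; exact/measurable_EFinP.
- exact/measurable_EFinP.
- by apply: aeW => x _; apply: cvg_EFin; [exact: nearW|exact: ff].
- exact: rint_cst.
- by apply: aeW => x n _; rewrite lee_fin.
move=> fi _ cvI; apply: fine_cvg; rewrite /Rintegral fineK//.
exact: integrable_fin_num.
Qed.

End real_integrable.

Section Rint_probability.
Context d (T : measurableType d) (R : realType) (P : probability T R).

Lemma Rint_cst k : \int[P]_x (k : R) = k.
Proof.
rewrite (Rintegral_cst P measurableT).
rewrite -[RHS]mulr1; congr (_ * _).
exact: (congr1 fine (probability_setT P)).
Qed.

End Rint_probability.

(** * One-dimensional Gaussian laws *)

(** Integrate over [[m - n, m + n]] and pass to the limit by dominated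
   convergence: only symmetric boundary terms have to vanish. *)
Lemma integral_derive_eq0 (R : realType) (F g : R -> R) (m : R) :
  (forall x : R, is_derive x 1 F (g x)) -> continuous g ->
  (@lebesgue_measure R).-integrable setT (EFin \o g) ->
  (F (m + n%:R) - F (m - n%:R)) @[n --> \oo] --> (0 : R) ->
  (\int[@lebesgue_measure R]_x (g x)%:E = 0)%E.
Proof.
move=> dF cg ig F0; set mu := lebesgue_measure.
pose f_ (n : nat) := (EFin \o g) \_ `[m - n%:R, m + n%:R].
have mg : measurable_fun [set: R] (EFin \o g) by exact: measurable_int ig.
have cF : continuous F.
  by move=> x; apply/differentiable_continuous/derivable1_diffP/ex_derive.
have [] := @dominated_convergence _ _ _ mu setT measurableT f_ (EFin \o g)
  (abse \o (EFin \o g)).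
- move=> n; apply/(measurable_restrictT _ _).1 => //.
  exact: measurable_funTS.
- exact: mg.
- apply: aeW => x _.
  apply: cvg_near_cst.
  exists (Num.truncn `|x - m|).+1 => // n /= xn.
  rewrite /f_ patchE ifT// inE /= in_itv/=.
  have : `|x - m| <= n%:R.
    by rewrite (le_trans (ltW (truncnS_gt _)))// ler_nat.
  by rewrite ler_norml; lra.
- exact: integrable_abse.
- apply: aeW => x n _; rewrite /f_ patchE; case: ifPn => // _.
  by rewrite abse0 abse_ge0.
move=> _ _; set I := integral _ _ _ => cvI.
have : (F (m + n.+1%:R) - F (m - n.+1%:R))%:E @[n --> \oo] --> I.
  move: cvI; rewrite -cvg_shiftS; apply: cvg_trans; apply: near_eq_cvg.
  apply: nearW => n /=.
  rewrite /f_ -integral_mkcond.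
  rewrite (@continuous_FTC2 _ _ F)//.
  - by have : 0 < n.+1%:R :> R by []; lra.
  - exact: continuous_subspaceT.
  - split.
    + by move=> x _; exact: ex_derive.
    + by apply: cvg_at_right_filter; exact: cF.
    + by apply: cvg_at_left_filter; exact: cF.
  - by move=> x _; rewrite derive1E; exact: derive_val.
move/cvg_unique; apply => //.
apply: cvg_EFin; first exact: nearW.
by move: F0; rewrite -cvg_shiftS.
Qed.

Section normal.
Variables (R : realType) (m s : R).
Hypothesis s_gt0 : 0 < s.
Local Notation mu := (@lebesgue_measure R).
Local Notation p := (normal_pdf m s).

Let s_neq0 : s != 0. Proof. by rewrite gt_eqF. Qed.

(** The density agrees almost everywhere with the Radon-Nikodym derivative,
   to which the change of variables applies. *)
Lemma ge0_integral_normal (f : R -> \bar R) : (forall x, 0 <= f x)%E ->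
  measurable_fun [set: R] f ->
  (\int[normal_prob m s]_x f x = \int[mu]_x (f x * (p x)%:E))%E.
Proof.
move=> f0 mf.
rewrite -(Radon_Nikodym_SigmaFinite.change_of_variables
  (normal_prob_dominates m s))//=.
have dom := normal_prob_dominates m s.
apply: ae_eq_integral => //.
- apply: emeasurable_funM => //.
  apply: (measurable_int mu).
  exact: Radon_Nikodym_SigmaFinite.f_integrable.
- apply: emeasurable_funM => //.
  by apply/measurable_EFinP; exact: measurable_normal_pdf.
- apply: ae_eqe_mul2l => /=.
  apply: integral_ae_eq => //=.
  + exact: Radon_Nikodym_SigmaFinite.f_integrable.
  + by apply/measurable_EFinP; exact: measurable_normal_pdf.
  + by move=> E _ mE; rewrite -Radon_Nikodym_SigmaFinite.f_integral.
Qed.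

Lemma integral_normal (f : R -> R) : measurable_fun [set: R] f ->
  (normal_prob m s).-integrable setT (EFin \o f) ->
  (\int[normal_prob m s]_x (f x)%:E = \int[mu]_x (f x * p x)%:E)%E.
Proof.
move=> mf fi.
have mf' : measurable_fun setT (EFin \o f) by exact/measurable_EFinP.
rewrite integralE [RHS]integralE; congr (_ - _)%E.
- rewrite ge0_integral_normal//; last exact: measurable_funepos.
  apply: eq_integral => x _.
  by rewrite !funeposE EFinM maxe_pMl ?lee_fin ?normal_pdf_ge0// mul0e.
- rewrite ge0_integral_normal//; last exact: measurable_funeneg.
  apply: eq_integral => x _.
  by rewrite !funenegE EFinM -mulNe maxe_pMl ?lee_fin ?normal_pdf_ge0// mul0e.
Qed.

Lemma is_derive_normal_pdf (x : R) :
  is_derive x 1 p (- ((x - m) / s ^+ 2) * p x).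
Proof.
rewrite normal_pdfE// /normal_fun.
apply: is_derive_eq.
by rewrite /GRing.scale/=; field.
Qed.

(** The cube is absorbed by doubling the standard deviation: [|x - m| ^ 3] times
   the density of parameter [s] is at most a multiple of the density of
   parameter [2 s]. *)
Lemma integral_normal_cube :
  (\int[normal_prob m s]_x (`|x - m| ^+ 3)%:E < +oo)%E.
Proof.
have mf : measurable_fun [set: R] (fun x : R => `|x - m| ^+ 3).
  apply: measurable_funX; apply: measurableT_comp => //.
  exact: measurable_funB.
rewrite ge0_integral_normal; [|move=> x; rewrite lee_fin; exact: exprn_ge0
  |exact/measurable_EFinP].
pose C := 1 + 32 * s ^+ 4.
pose D := C * (normal_peak s / normal_peak (2 * s)).
have s2_neq0 : 2 * s != 0 by rewrite mulf_neq0.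
apply: (@le_lt_trans _ _ (\int[mu]_x (D * normal_pdf m (2 * s) x)%:E)%E).
  apply: ge0_le_integral => //.
  - by move=> x _; rewrite -EFinM lee_fin mulr_ge0 ?exprn_ge0// normal_pdf_ge0.
  - apply/measurable_EFinP; apply: measurable_funM => //.
    exact: measurable_normal_pdf.
  - apply/measurable_EFinP; apply: measurable_funM => //.
    exact: measurable_normal_pdf.
  - move=> x _; rewrite -EFinM lee_fin !normal_pdfE//.
    rewrite /D; set a := normal_peak s; set b := normal_peak (2 * s).
    have b0 : 0 < b by exact: normal_peak_gt0.
    have -> : C * (a / b) * (b * normal_fun m (2 * s) x) =
      a * (C * normal_fun m (2 * s) x) by field; rewrite gt_eqF.
    rewrite mulrCA ler_wpM2l ?normal_peak_ge0//.
    rewrite /normal_fun.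
    (* the wider density has exponent [- w], the narrower one [- 4 w]; three
       quarters of the decay are spent on the polynomial factor *)
    set w := (x - m) ^+ 2 / (8 * s ^+ 2).
    have -> : - (x - m) ^+ 2 / (s ^+ 2 *+ 2) = - (3 * w) + - w.
      by rewrite /w; field.
    have -> : - (x - m) ^+ 2 / ((2 * s) ^+ 2 *+ 2) = - w.
      by rewrite /w; field.
    have w0 : 0 <= w by rewrite mulr_ge0// ?sqr_ge0// invr_ge0 mulr_ge0// sqr_ge0.
    rewrite expRD mulrA ler_wpM2r ?expR_ge0//.
    have x4 : `|x - m| ^+ 3 <= 1 + `|x - m| ^+ 4.
      set r := `|_|; have r0 : 0 <= r by exact: normr_ge0.
      have [r1|/ltW r1] := leP r 1.
        by rewrite (le_trans (exprn_ile1 _ _ r1))// lerDl exprn_ge0.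
      by apply: (@le_trans _ _ (r ^+ 4)); [exact: ler_weXn2l|rewrite lerDr].
    have x4w : `|x - m| ^+ 4 = 64 * s ^+ 4 * w ^+ 2.
      have -> : `|x - m| ^+ 4 = (`|x - m| ^+ 2) ^+ 2 by rewrite -exprM.
      by rewrite real_normK ?num_real// /w; field.
    have e3 : 1 + 2 * w ^+ 2 <= expR (3 * w).
      have -> : 3 * w = 3 / 2 * w + 3 / 2 * w by field.
      have := expR_ge1Dx (3 / 2 * w); rewrite expRD.
      set e := expR _ => h; nra.
    rewrite expRN ler_pdivrMr ?expR_gt0//.
    apply: (le_trans x4); rewrite x4w.
    have s4 : 0 <= s ^+ 4 by rewrite exprn_ge0// ltW.
    have C0 : 0 <= C by rewrite addr_ge0// mulr_ge0.
    apply: le_trans (ler_wpM2l C0 e3).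
    have : 0 <= w ^+ 2 by rewrite sqr_ge0.
    by rewrite /C; move: (s ^+ 4) (w ^+ 2) s4 => u v u0 v0; nra.
rewrite /=; under eq_integral do rewrite EFinM.
rewrite integralZl//; last exact: integrable_normal_pdf.
by rewrite integral_normal_pdf// mule1 ltry.
Qed.

Local Notation N := (normal_prob m s).

Lemma integrable_normal_cube :
  N.-integrable [set: R] (fun x => (`|x - m| ^+ 3)%:E).
Proof.
apply/integrableP; split.
  apply/measurable_EFinP; apply: measurable_funX; apply: measurableT_comp => //.
  exact: measurable_funB.
under eq_integral do rewrite gee0_abs ?lee_fin ?exprn_ge0//.
exact: integral_normal_cube.
Qed.

Lemma integrable_normal_affine (f : R -> R) (A B : R) :
  measurable_fun [set: R] f -> (forall x, `|f x| <= A + B * `|x - m|) ->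
  0 <= B -> N.-integrable [set: R] (EFin \o f).
Proof.
move=> mf fAB B0.
apply: (@rint_le _ _ _ N f (fun x => (A + B) + B * `|x - m| ^+ 3)) => //.
- move=> x; apply: (le_trans (fAB x)).
  rewrite -addrA lerD2l -[in leRHS](mulr1 B) -mulrA -mulrDr ler_wpM2l// mul1r.
  set r := `|_|; have r0 : 0 <= r by exact: normr_ge0.
  have [r1|/ltW r1] := leP r 1.
    by rewrite (le_trans r1)// lerDl exprn_ge0.
  by apply: (@le_trans _ _ (r ^+ 3)); [rewrite -[leLHS]expr1 ler_weXn2l|rewrite lerDr].
- apply: rintD; first exact: rint_cst.
  by apply: rintZ; exact: integrable_normal_cube.
Qed.

Let wave (a t x : R) := cos (a * (x - m) + t).

Let measurable_lin (a t : R) : measurable_fun [set: R] (fun x => a * (x - m) + t).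
Proof.
by apply: measurable_funD => //; apply: measurable_funM => //; exact: measurable_funB.
Qed.

Let continuous_lin (a t : R) : continuous (fun x : R => a * (x - m) + t).
Proof.
move=> x; apply: cvgD; last exact: cvg_cst.
apply: cvgM; first exact: cvg_cst.
by apply: cvgB; [exact: cvg_id|exact: cvg_cst].
Qed.

Let measurable_wave a t : measurable_fun [set: R] (wave a t).
Proof.
apply: measurableT_comp; last exact: measurable_lin.
by apply: continuous_measurable_fun; exact: continuous_cos.
Qed.

Let measurable_swave a t :
  measurable_fun [set: R] (fun x => (x - m) * sin (a * (x - m) + t)).
Proof.
apply: measurable_funM; first exact: measurable_funB.
apply: measurableT_comp; last exact: measurable_lin.
by apply: continuous_measurable_fun; exact: continuous_sin.
Qed.

Let integrable_wave a t : N.-integrable setT (EFin \o wave a t).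
Proof.
apply: (@integrable_normal_affine _ 1 0) => // x.
by rewrite mul0r addr0 cos_max.
Qed.

Let integrable_swave a t :
  N.-integrable setT (EFin \o (fun x => (x - m) * sin (a * (x - m) + t))).
Proof.
apply: (@integrable_normal_affine _ 0 1) => // x.
by rewrite mul1r add0r normrM ler_piMr ?normr_ge0// sin_max.
Qed.

(** Gaussian integration by parts: the two sides differ by the integral of the
   derivative of [s ^ 2 * sin (a (x - m) + t) * p x]. *)
Lemma normal_stein (a t : R) :
  (\int[N]_x ((x - m) * sin (a * (x - m) + t)) =
   s ^+ 2 * a * \int[N]_x (wave a t x))%R.
Proof.
pose h x := s ^+ 2 * a * wave a t x - (x - m) * sin (a * (x - m) + t).
have ih : N.-integrable setT (EFin \o h).
  apply: rintB; last exact: integrable_swave.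
  by apply: rintZ; exact: integrable_wave.
have mh : measurable_fun [set: R] h by exact: (rint_measurable ih).
suff h0 : \int[N]_x h x = 0.
  apply/eqP; rewrite eq_sym -subr_eq0 -h0; apply/eqP.
  rewrite RintB; [|by apply: rintZ; exact: integrable_wave|exact: integrable_swave].
  by rewrite RintZ//; exact: integrable_wave.
rewrite /Rintegral integral_normal//.
pose F x := s ^+ 2 * sin (a * (x - m) + t) * p x.
have dF (x : R) : is_derive x 1 F (h x * p x).
  have := is_derive_normal_pdf x => dp.
  rewrite /F /h /wave; apply: is_derive_eq.
  by rewrite /GRing.scale/=; field.
rewrite (@integral_derive_eq0 _ F _ m)//.
- move=> x; apply: cvgM; last exact: continuous_normal_pdf.
  apply: cvgB; apply: cvgM; try exact: cvg_cst.
  + by apply: continuous_comp; [exact: continuous_lin|exact: continuous_cos].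
  + by apply: cvgB; [exact: cvg_id|exact: cvg_cst].
  + by apply: continuous_comp; [exact: continuous_lin|exact: continuous_sin].
- apply/integrableP; split.
    apply/measurable_EFinP; apply: measurable_funM => //.
    exact: measurable_normal_pdf.
  have /integrableP[_] := ih.
  rewrite ge0_integral_normal//; last first.
    by apply: measurableT_comp => //; exact/measurable_EFinP.
  apply: le_lt_trans; rewrite le_eqVlt; apply/orP; left; apply/eqP.
  by apply: eq_integral => x _; rewrite /= normrM EFinM (ger0_norm (normal_pdf_ge0 _ _ _)).
- pose q := expR (- (s ^+ 2 *+ 2)^-1).
  have s2 : 0 < s ^+ 2 *+ 2 by rewrite mulrn_wgt0// exprn_gt0.
  have pq (n : nat) (y : R) : `|y| = n%:R -> p (m + y) <= normal_peak s * q ^+ n.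
    move=> yn; rewrite normal_pdfE// ler_wpM2l ?normal_peak_ge0//.
    rewrite /normal_fun /q -expRM_natl ler_expR.
    have -> : m + y - m = y by ring.
    have -> : y ^+ 2 = n%:R ^+ 2 by rewrite -yn real_normK// num_real.
    rewrite mulNr mulrN lerN2.
    rewrite ler_wpM2r//; first by rewrite invr_ge0 ltW.
    rewrite -natrX ler_nat.
    by case: n {yn} => // n; rewrite -mulnn leq_pmull.
  have FB (n : nat) (y : R) : `|y| = n%:R ->
      `|F (m + y)| <= s ^+ 2 * normal_peak s * q ^+ n.
    move=> yn; rewrite /F; move: (s ^+ 2) (sqr_ge0 s) => v v0.
    rewrite 2!normrM (ger0_norm (normal_pdf_ge0 _ _ _)) (ger0_norm v0) -2!mulrA.
    apply: (ler_wpM2l v0).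
    apply: (le_trans _ (pq n y yn)); rewrite ler_piMl ?normal_pdf_ge0//.
    exact: sin_max.
  apply: norm_cvg0.
  apply: (@squeeze_cvgr _ _ _ _ (cst 0) (fun n => 2 * (s ^+ 2 * normal_peak s) * q ^+ n)).
  + apply: nearW => n; rewrite normr_ge0/=.
    apply: (le_trans (ler_normB _ _)).
    rewrite -mulrA mulrDl !mul1r lerD// FB// ?normrN ger0_norm//.
  + exact: cvg_cst.
  + rewrite -[X in _ --> X](mulr0 (2 * (s ^+ 2 * normal_peak s))).
    apply: cvgM; first exact: cvg_cst.
    apply: cvg_expr; rewrite ger0_norm ?expR_ge0// -expR0 ltr_expR oppr_lt0.
    by rewrite invr_gt0.
Qed.

(** By [normal_stein] the left-hand side [f] solves [f' a = - s ^ 2 * a * f a]. *)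
Lemma normal_wave (a t : R) :
  \int[N]_x (wave a t x) = cos t * expR (- (a ^+ 2 * s ^+ 2 / 2)).
Proof.
pose f a := \int[N]_x (wave a t x).
have df (b : R) : is_derive b 1 f (- (s ^+ 2 * b * f b)).
  have dw (x c : R) : is_derive c 1 (fun a => wave a t x)
      (- ((x - m) * sin (c * (x - m) + t))).
    rewrite /wave; apply: is_derive_eq.
    by rewrite /GRing.scale/=; ring.
  have Ib : b \in `]b - 1, b + 1[ by rewrite in_itv/=; lra.
  have intw c : c \in `]b - 1, b + 1[ -> N.-integrable setT (EFin \o wave c t).
    by [].
  have derw c x : c \in `]b - 1, b + 1[ -> [set: R] x ->
      derivable (fun a => wave a t x) c 1.
    by move=> _ _; exact: ex_derive.
  have G0 (x : R) : 0 <= `|x - m| by [].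
  have iG : N.-integrable [set: R] (EFin \o (fun x => `|x - m|)).
    apply: (@integrable_normal_affine _ 0 1) => //.
      by apply: measurableT_comp => //; exact: measurable_funB.
    by move=> x; rewrite normr_id mul1r add0r.
  have GB c x : c \in `]b - 1, b + 1[ -> [set: R] x ->
      `|partial1of2 (fun a x => wave a t x) c x| <= `|x - m|.
    move=> _ _; rewrite partial1of2E (@derive_val _ _ _ _ _ _ _ (dw x c)).
    by rewrite normrN normrM ler_piMr// sin_max.
  have dab := derivable_under_integral measurableT Ib intw derw G0 iG GB.
  have dval := differentiation_under_integral measurableT Ib intw derw G0 iG GB.
  apply: DeriveDef; first exact: dab.
  rewrite -derive1E dval -normal_stein.
  rewrite (_ : (fun _ => _) = fun x => -1 * ((x - m) * sin (b * (x - m) + t)));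
    last first.
    apply/funext => x; rewrite partial1of2E (@derive_val _ _ _ _ _ _ _ (dw x b)).
    by rewrite mulN1r.
  by rewrite RintZ ?mulN1r//; exact: integrable_swave.
pose g b := f b * expR (b ^+ 2 * s ^+ 2 / 2).
have dg (b : R) : is_derive b 1 g 0.
  have := df b => dfb; rewrite /g; apply: is_derive_eq.
  by rewrite /GRing.scale/=; field.
have := is_derive_0_is_cst a 0 dg.
have -> : g 0 = cos t.
  rewrite /g expr0n !mul0r expR0 mulr1 /f /wave.
  under eq_Rintegral do rewrite mul0r add0r.
  exact: Rint_cst.
rewrite /g => <-; rewrite -(mulrA (f a)) -expRD subrr expR0 mulr1//.
Qed.

Lemma normal_mean : \int[N]_x (x - m) = 0.
Proof.
(* frequency [0] and phase [pi / 2] make the sine equal to [1] *)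
have := normal_stein 0 (pi / 2).
rewrite mulr0 mul0r => <-; apply: eq_Rintegral => x _.
by rewrite mul0r add0r sin_pihalf mulr1.
Qed.

End normal.

Section gaussian_variable.
Context d (T : measurableType d) (R : realType) (P : probability T R).
Variable Z : T -> R.
Hypothesis mZ : measurable_fun [set: T] Z.

Let Zf : {mfun T >-> measurableTypeR R} := mfun_Sub (mem_set mZ : (Z : T -> measurableTypeR R) \in mfun).

Lemma Rintegral_law (nu : probability (measurableTypeR R) R) (f : R -> R) :
  (forall A : set R, measurable A -> P (Z @^-1` A) = nu A) ->
  nu.-integrable [set: R] (EFin \o f) ->
  P.-integrable [set: T] (EFin \o (f \o Z)) /\
  \int[P]_w f (Z w) = \int[nu]_x f x.
Proof.
move=> law fi.
have mf : measurable_fun [set: R] f by exact: (rint_measurable fi).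
have mf' : measurable_fun [set: R] (EFin \o f) by exact/measurable_EFinP.
have E (g : R -> \bar R) :
    (\int[nu]_x g x = \int[pushforward P Zf]_x g x)%E.
  by apply: eq_measure_integral => A mA _; exact: (esym (law A mA)).
have ifZ : P.-integrable [set: T] (EFin \o (f \o Z)).
  apply/integrableP; split.
    by apply/measurable_EFinP; exact: measurableT_comp.
  have /integrableP[_] := fi; apply: le_lt_trans.
  rewrite le_eqVlt; apply/orP; left; apply/eqP.
  by rewrite E ge0_integral_pushforward//; exact: measurableT_comp.
split=> //; rewrite /Rintegral; congr fine.
by rewrite E integral_pushforward.
Qed.

(** What the comparison needs of a Gaussian variable, in a form that is the same
   for diffuse and for degenerate laws: [s] may be [0]. *)
Lemma gaussian_facts : is_gaussian P Z -> exists mu s : R,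
  [/\ P.-integrable [set: T] (EFin \o (fun w => `|Z w - mu| ^+ 3)),
      \int[P]_w (Z w - mu) = 0 &
      forall a t, \int[P]_w cos (a * (Z w - mu) + t) =
                  cos t * expR (- (a ^+ 2 * s ^+ 2 / 2))].
Proof.
move=> [mu [s [s0 law]]]; exists mu, s.
have mcos a t : measurable_fun [set: R] (fun x => cos (a * (x - mu) + t)).
  apply: measurableT_comp.
    by apply: continuous_measurable_fun; exact: continuous_cos.
  by apply: measurable_funD => //; apply: measurable_funM => //; exact: measurable_funB.
have [s_eq0|s_neq0] := eqVneq s 0.
  have law0 A : measurable A -> P (Z @^-1` A) = \d_mu A.
    by move=> mA; rewrite law// /gaussian_law s_eq0 eqxx.
  have Rint f : measurable_fun [set: R] f -> P.-integrable [set: T] (EFin \o (f \o Z)) /\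
      \int[P]_w f (Z w) = f mu.
    move=> mf.
    have := @Rintegral_law (@dirac _ (measurableTypeR R) mu R) f law0.
    rewrite /Rintegral integral_dirac//; last exact/measurable_EFinP.
    rewrite diracT mul1e/=; apply.
    apply/integrableP; split; first exact/measurable_EFinP.
    rewrite integral_dirac//; last by apply: measurableT_comp => //; exact/measurable_EFinP.
    by rewrite diracT mul1e/= ltry.
  split.
  - have [] // := Rint (fun x => `|x - mu| ^+ 3).
    apply: measurable_funX; apply: measurableT_comp => //.
    exact: measurable_funB.
  - have [|_ ->] := Rint (fun x => x - mu); last by rewrite subrr.
    exact: measurable_funB.
  - move=> a t; have [|_ ->] // := Rint (fun x => cos (a * (x - mu) + t)).
    by rewrite subrr mulr0 add0r s_eq0 expr0n mulr0 mul0r oppr0 expR0 mulr1.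
have s_gt0 : 0 < s by rewrite lt_neqAle eq_sym s_neq0.
have law1 A : measurable A -> P (Z @^-1` A) = normal_prob mu s A.
  by move=> mA; rewrite law// /gaussian_law (negbTE s_neq0).
split.
- by have [] := Rintegral_law law1 (integrable_normal_cube mu s_gt0).
- rewrite -(normal_mean mu s_gt0).
  apply: (proj2 (@Rintegral_law _ (fun x => x - mu) law1 _)).
  apply: (@integrable_normal_affine _ _ _ s_gt0 _ 0 1) => //.
    exact: measurable_funB.
  by move=> x; rewrite mul1r add0r.
- move=> a t; rewrite -(normal_wave mu s_gt0).
  apply: (proj2 (@Rintegral_law _ (fun x => cos (a * (x - mu) + t)) law1 _)).
  by apply: (@rint_bounded _ _ _ _ _ 1) => [|x]; [exact: mcos|exact: cos_max].
Qed.

End gaussian_variable.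

(** * The law of a finite family is determined by cosine averages *)

Section newton_sg.
Context (R : realType).
Implicit Types u : R.

(** Newton iteration for the sign: a polynomial map with attracting fixed points
   [-1] and [1]. *)
Definition newton_sg u := u * (3 - u ^+ 2) / 2.

Lemma newton_sgN n u : iter n newton_sg (- u) = - iter n newton_sg u.
Proof. by elim: n => //= n ->; rewrite /newton_sg sqrrN !mulNr. Qed.

(** One step multiplies the gap [1 - v] by [1 - (v + v ^ 2) / 2], which is at most
   [1 - u / 2] as long as [v] stays above the starting point [u]. *)
Lemma newton_sg_bounds n u : 0 < u <= 1 ->
  [/\ u <= iter n newton_sg u, iter n newton_sg u <= 1 &
      1 - iter n newton_sg u <= (1 - u / 2) ^+ n].
Proof.
move=> /andP[u0 u1]; elim: n => [|n]; first by rewrite expr0/=; split => //; lra.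
rewrite iterS /newton_sg; move: (iter n _ u) => v [uv v1 vn].
have h1 : 0 <= v * (1 - v) * (1 + v) by rewrite !mulr_ge0//; lra.
have h2 : 0 <= (1 - v) ^+ 2 * (v + 2) by rewrite mulr_ge0 ?sqr_ge0//; lra.
split.
- by apply: (le_trans uv); nra.
- by nra.
- rewrite (exprSr _ n).
  have -> : 1 - v * (3 - v ^+ 2) / 2 = (1 - v) * (1 - (v + v ^+ 2) / 2) by field.
  apply: ler_pM => //; nra.
Qed.

Lemma newton_sg_le1 n u : `|u| <= 1 -> `|iter n newton_sg u| <= 1.
Proof.
have pos v : 0 < v <= 1 -> `|iter n newton_sg v| <= 1.
  move=> v01; have [h1 h2 _] := newton_sg_bounds n v01.
  by rewrite ler_norml h2 andbT; lra.
rewrite ler_norml => /andP[u1 u2]; have [u0|u0|->] := ltgtP u 0.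
- by rewrite -(opprK u) newton_sgN normrN pos//; lra.
- by rewrite pos// u0.
- rewrite (_ : iter _ _ _ = 0) ?normr0//.
  by elim: n {pos} => //= n ->; rewrite /newton_sg mul0r mul0r.
Qed.

Lemma newton_sg_cvg u : `|u| <= 1 -> iter n newton_sg u @[n --> \oo] --> Num.sg u.
Proof.
have pos v : 0 < v <= 1 -> iter n newton_sg v @[n --> \oo] --> (1 : R).
  move=> v01.
  apply: (@squeeze_cvgr _ _ _ _ (fun n => 1 - (1 - v / 2) ^+ n) (cst 1)).
  - apply: nearW => n; have [h1 h2 h3] := newton_sg_bounds n v01.
    by rewrite h2 andbT; lra.
  - rewrite -[X in _ --> X]subr0; apply: cvgB; first exact: cvg_cst.
    by apply: cvg_expr; rewrite ger0_norm; lra.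
  - exact: cvg_cst.
rewrite ler_norml => /andP[u1 u2]; have [u0|u0|->] := ltgtP u 0.
- rewrite ltr0_sg// (_ : (fun _ => _) = fun n => - iter n newton_sg (- u)).
    by apply: cvgN; apply: pos; lra.
  by apply/funext => n; rewrite newton_sgN opprK.
- by rewrite gtr0_sg//; apply: pos; rewrite u0.
- rewrite sgr0 (_ : (fun _ => _) = fun=> 0); first exact: cvg_cst.
  apply/funext => n.
  by elim: n {pos} => //= n ->; rewrite /newton_sg mul0r mul0r.
Qed.

End newton_sg.
Arguments newton_sg {R} u.

Section real_family.
Context (R : realType) (I : finType).

(** Extended-real corners leave coordinates unconstrained when infinite, and make
   the boxes stable under intersection. *)
Definition boxes : set (set (I -> R)) :=
  [set B | exists c : I -> \bar R, B = [set v | forall i, ((v i)%:E < c i)%E]].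

Definition rvec := g_sigma_algebraType boxes.

Lemma boxesT : boxes [set: I -> R].
Proof.
by exists (fun=> +oo%E); apply/seteqP; split=> // v _ i; rewrite ltry.
Qed.

Lemma boxesI : setI_closed boxes.
Proof.
move=> _ _ [c ->] [c' ->]; exists (fun i => Order.min (c i) (c' i)).
apply/seteqP; split=> v /=.
  by move=> [h h'] i; rewrite lt_min h h'.
by move=> h; split=> i; have := h i; rewrite lt_min => /andP[].
Qed.

Lemma measurable_box d (T : measurableType d) (U : I -> T -> R) (c : I -> \bar R) :
  (forall i, measurable_fun [set: T] (U i)) ->
  measurable [set w | forall i, ((U i w)%:E < c i)%E].
Proof.
move=> mU.
rewrite (_ : [set w | _] = \bigcap_(i in [set: I]) [set w | ((U i w)%:E < c i)%E]).
    apply: fin_bigcap_measurable => // i _.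
    have := emeasurable_fun_infty_o measurableT ((measurable_EFinP _ _).2 (mU i)) (c i).
    by rewrite setTI.
  apply/seteqP; split=> w /= h i; first by move=> _; exact: h.
  exact: h.
Qed.

Lemma measurable_coord i : measurable_fun [set: rvec] (fun v => v i).
Proof.
apply: (measurability _ (RGenInftyO.measurableE R)) => //.
move=> _ [_ [x ->] <-]; rewrite setTI; apply: sub_sigma_algebra.
exists (fun j => if j == i then x%:E else +oo%E).
apply/seteqP; split=> v /=; rewrite in_itv/=.
  by move=> h j; case: eqP => [->|_]; rewrite ?lte_fin// ltry.
by move=> /(_ i); rewrite eqxx lte_fin.
Qed.

Lemma measurable_rvec d (T : measurableType d) (V : I -> T -> R) :
  (forall i, measurable_fun [set: T] (V i)) ->
  measurable_fun [set: T] (fun w => (V^~ w : rvec)).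
Proof.
move=> mV; apply: measurability; first by reflexivity.
move=> _ [_ [c ->] <-]; rewrite setTI.
exact: measurable_box.
Qed.

End real_family.

Section law_uniqueness.
Context (R : realType) (I : finType).
Context d (T : measurableType d) (P : probability T R).
Context d' (T' : measurableType d') (P' : probability T' R).
Variables (V : I -> T -> R) (V' : I -> T' -> R).
Hypotheses (mV : forall i, measurable_fun [set: T] (V i))
           (mV' : forall i, measurable_fun [set: T'] (V' i)).

Let lin (xi v : I -> R) := \sum_i xi i * v i.

(** [psi] and [psi'] are weights under which the two families have the same cosine
   averages. *)
Let equi (psi : T -> R) (psi' : T' -> R) : Prop :=
  [/\ measurable_fun [set: T] psi, measurable_fun [set: T'] psi',
      exists k : R, (forall w, `|psi w| <= k) /\ (forall w, `|psi' w| <= k) &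
      forall xi t, \int[P]_w (cos (lin xi (V^~ w) + t) * psi w) =
                   \int[P']_w (cos (lin xi (V'^~ w) + t) * psi' w)].

(** The functionals that can be inserted as a factor in such an equality. *)
Let adm (phi : (I -> R) -> R) : Prop := forall psi psi', equi psi psi' ->
  equi (fun w => phi (V^~ w) * psi w) (fun w => phi (V'^~ w) * psi' w).

Let measurable_cos_lin d0 (T0 : measurableType d0) (U : I -> T0 -> R) xi t :
  (forall i, measurable_fun [set: T0] (U i)) ->
  measurable_fun [set: T0] (fun w => cos (lin xi (U^~ w) + t)).
Proof.
move=> mU; apply: (measurableT_comp (f := cos)).
  by apply: continuous_measurable_fun; exact: continuous_cos.
apply: measurable_funD => //; apply: measurable_sum => i.
exact: measurable_funM.
Qed.

Let intg_cos d0 (T0 : measurableType d0) (P0 : probability T0 R)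
  (U : I -> T0 -> R) (psi : T0 -> R) (k : R) xi t : (forall i, measurable_fun [set: T0] (U i)) ->
  measurable_fun [set: T0] psi -> (forall w, `|psi w| <= k) ->
  P0.-integrable [set: T0] (EFin \o (fun w => cos (lin xi (U^~ w) + t) * psi w)).
Proof.
move=> mU mpsi psik; apply: (@rint_bounded _ _ _ _ _ k).
  by apply: measurable_funM => //; exact: measurable_cos_lin.
by move=> w; rewrite normrM (le_trans _ (psik w))// ler_piMl// cos_max.
Qed.

Let linD xi xi' v : lin (fun i => xi i + xi' i) v = lin xi v + lin xi' v.
Proof. by rewrite -big_split/=; apply: eq_bigr => i _; rewrite mulrDl. Qed.

Let linB xi xi' v : lin (fun i => xi i - xi' i) v = lin xi v - lin xi' v.
Proof. by rewrite -sumrB; apply: eq_bigr => i _; rewrite mulrBl. Qed.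

Let adm_ext phi phi' : phi =1 phi' -> adm phi -> adm phi'.
Proof. by move=> /funext ->. Qed.

(** The product of two cosines is a half-sum of cosines. *)
Let adm_wave xi t : adm (fun v => cos (lin xi v + t)).
Proof.
move=> psi psi' [m m' [k [bk bk']] E]; split.
- by apply: measurable_funM => //; exact: measurable_cos_lin.
- by apply: measurable_funM => //; exact: measurable_cos_lin.
- exists k; split=> w; rewrite normrM.
    by rewrite (le_trans _ (bk w))// ler_piMl// cos_max.
  by rewrite (le_trans _ (bk' w))// ler_piMl// cos_max.
- move=> xi0 t0.
  have prodE v x : cos (lin xi0 v + t0) * (cos (lin xi v + t) * x) =
    2^-1 * (cos (lin (fun i => xi0 i + xi i) v + (t0 + t)) * x +
            cos (lin (fun i => xi0 i - xi i) v + (t0 - t)) * x).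
    rewrite linD linB.
    have -> : lin xi0 v + lin xi v + (t0 + t) = (lin xi0 v + t0) + (lin xi v + t).
      by ring.
    have -> : lin xi0 v - lin xi v + (t0 - t) = (lin xi0 v + t0) - (lin xi v + t).
      by ring.
    by move: (lin xi0 v + t0) (lin xi v + t) => A B; rewrite cosB cosD; field.
  under eq_Rintegral do rewrite prodE.
  under [RHS]eq_Rintegral do rewrite prodE.
  rewrite !RintZ ?RintD ?E//; try exact: (@intg_cos _ _ _ _ _ k);
    by apply: rintD; exact: (@intg_cos _ _ _ _ _ k).
Qed.

Let adm_cst c : adm (fun=> c).
Proof.
move=> psi psi' [m m' [k [bk bk']] E]; split.
- exact: measurable_funM.
- exact: measurable_funM.
- by exists (`|c| * k); split=> w; rewrite normrM ler_wpM2l.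
- move=> xi t.
  under eq_Rintegral do rewrite mulrCA.
  under [RHS]eq_Rintegral do rewrite mulrCA.
  by rewrite !RintZ ?E//; exact: (@intg_cos _ _ _ _ _ k).
Qed.

Let adm_mul phi phi' : adm phi -> adm phi' -> adm (fun v => phi v * phi' v).
Proof.
move=> a a' psi psi' e; have := a _ _ (a' _ _ e).
by congr equi; apply/funext => w; rewrite mulrA.
Qed.

Let adm_add phi phi' : adm phi -> adm phi' -> adm (fun v => phi v + phi' v).
Proof.
move=> a a' psi psi' e.
have [m1 m1' [k1 [b1 b1']] E1] := a _ _ e.
have [m2 m2' [k2 [b2 b2']] E2] := a' _ _ e.
split.
- by under eq_fun do rewrite mulrDl; exact: measurable_funD.
- by under eq_fun do rewrite mulrDl; exact: measurable_funD.
- by exists (k1 + k2); split=> w;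
    rewrite mulrDl (le_trans (ler_normD _ _))// lerD.
- move=> xi t.
  under eq_Rintegral do rewrite mulrDl mulrDr.
  under [RHS]eq_Rintegral do rewrite mulrDl mulrDr.
  rewrite !RintD ?E1 ?E2//;
    by [exact: (@intg_cos _ _ _ _ _ k1)|exact: (@intg_cos _ _ _ _ _ k2)].
Qed.

Let adm_prod (J : Type) (r : seq J) (phi : J -> (I -> R) -> R) :
  (forall j, adm (phi j)) -> adm (fun v => \prod_(j <- r) phi j v).
Proof.
move=> a; elim: r => [|j r IH].
  by apply: adm_ext (adm_cst 1) => v; rewrite big_nil.
by apply: adm_ext (adm_mul (a j) IH) => v; rewrite big_cons.
Qed.

Let adm_lim (phi_ : nat -> (I -> R) -> R) phi (k : R) :
  (forall n, adm (phi_ n)) -> (forall n v, `|phi_ n v| <= k) ->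
  (forall v, phi_ n v @[n --> \oo] --> phi v) -> adm phi.
Proof.
move=> a bphi cphi psi psi' e.
have [_ _ [l [bl bl']] _] := e.
have cv (x : R) v : phi_ n v * x @[n --> \oo] --> phi v * x.
  by apply: cvgM; [exact: cphi|exact: cvg_cst].
have bphi' v : `|phi v| <= k.
  have c : `|phi_ n v| @[n --> \oo] --> `|phi v| by apply: cvg_norm; exact: cphi.
  rewrite -(cvg_lim (@Rhausdorff R) c).
  by apply: limr_le; [apply/cvg_ex; exists (`|phi v|) | exact: nearW].
have m : measurable_fun [set: T] (fun w => phi (V^~ w) * psi w).
  apply: (@measurable_fun_cvg _ _ _ _ (fun n w => phi_ n (V^~ w) * psi w)).
    by move=> n; have [] := a n _ _ e.
  by move=> w _; exact: cv.
have m' : measurable_fun [set: T'] (fun w => phi (V'^~ w) * psi' w).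
  apply: (@measurable_fun_cvg _ _ _ _ (fun n w => phi_ n (V'^~ w) * psi' w)).
    by move=> n; have [] := a n _ _ e.
  by move=> w _; exact: cv.
split => //.
- by exists (k * l); split=> w; rewrite normrM ler_pM.
- move=> xi t.
  have c1 : \int[P]_w (cos (lin xi (V^~ w) + t) * (phi_ n (V^~ w) * psi w))
      @[n --> \oo] --> \int[P]_w (cos (lin xi (V^~ w) + t) * (phi (V^~ w) * psi w)).
    apply: (@bounded_cvg_Rintegral _ _ _ _ _ _ (k * l)).
    + move=> n; apply: measurable_funM; first exact: measurable_cos_lin.
      by have [] := a n _ _ e.
    + move=> n w; rewrite !normrM (@le_trans _ _ (`|phi_ n (V^~ w)| * `|psi w|))//.
        by rewrite ler_piMl ?mulr_ge0// cos_max.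
      by rewrite ler_pM.
    + by move=> w; apply: cvgM; [exact: cvg_cst|exact: cv].
  have c2 : \int[P']_w (cos (lin xi (V'^~ w) + t) * (phi_ n (V'^~ w) * psi' w))
      @[n --> \oo] --> \int[P']_w (cos (lin xi (V'^~ w) + t) * (phi (V'^~ w) * psi' w)).
    apply: (@bounded_cvg_Rintegral _ _ _ _ _ _ (k * l)).
    + move=> n; apply: measurable_funM; first exact: measurable_cos_lin.
      by have [] := a n _ _ e.
    + move=> n w; rewrite !normrM (@le_trans _ _ (`|phi_ n (V'^~ w)| * `|psi' w|))//.
        by rewrite ler_piMl ?mulr_ge0// cos_max.
      by rewrite ler_pM.
    + by move=> w; apply: cvgM; [exact: cvg_cst|exact: cv].
  apply: (cvg_unique _ c1); first exact: Rhausdorff.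
  apply: cvg_trans c2; apply: near_eq_cvg; apply: nearW => n.
  by have [_ _ _ ->] := a n _ _ e.
Qed.

Let adm_sin l a c : adm (fun v => sin (a * (v l - c))).
Proof.
apply: adm_ext (adm_wave (fun i => (i == l)%:R * a) (- (a * c) - pi / 2)) => v.
rewrite /lin (bigD1 l)//= eqxx mul1r big1 ?addr0; last first.
  by move=> i /negbTE ->; rewrite !mul0r.
rewrite addrA cosB cos_pihalf sin_pihalf mulr0 add0r mulr1; congr sin; ring.
Qed.

Let adm_newton phi n : adm phi -> adm (fun v => iter n newton_sg (phi v)).
Proof.
move=> a; elim: n => [//|n IH].
apply: adm_ext (adm_mul (adm_cst 2^-1) (adm_mul IH (adm_add (adm_cst 3)
  (adm_mul (adm_cst (-1)) (adm_mul IH IH))))) => v.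
rewrite iterS /newton_sg; move: (iter _ _ _) => u; ring.
Qed.

Let adm_sg_sin l a c : adm (fun v => Num.sg (sin (a * (v l - c)))).
Proof.
apply: (@adm_lim (fun n v => iter n newton_sg (sin (a * (v l - c)))) _ 1).
- by move=> n; apply: adm_newton; exact: adm_sin.
- by move=> n v; apply: newton_sg_le1; exact: sin_max.
- by move=> v; apply: newton_sg_cvg; exact: sin_max.
Qed.

(** As the frequency tends to [0], the square wave around [c] becomes a sign. *)
Let adm_sg l c : adm (fun v => Num.sg (v l - c)).
Proof.
apply: (@adm_lim (fun n v => Num.sg (sin (n.+1%:R^-1 * (v l - c)))) _ 1).
- by move=> n; exact: adm_sg_sin.
- by move=> n v; rewrite normr_sg; case: (_ != 0).
- move=> v; apply: cvg_near_cst.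
  have pos (x : R) : 0 < x ->
      \forall n \near \oo, 0 < sin (n.+1%:R^-1 * x).
    move=> x0; exists (Num.truncn (x / pi)) => // n /= xn.
    apply: sin_gt0_pi; rewrite mulr_gt0//= mulrC ltr_pdivrMr//.
    rewrite mulrC -ltr_pdivrMr ?pi_gt0//.
    by rewrite (lt_le_trans (truncnS_gt _))// ler_nat.
  have [x0|x0|x0] := ltgtP (v l - c) 0.
  + have := pos (- (v l - c)); rewrite oppr_gt0 => /(_ x0).
    apply: filterS => n; rewrite mulrN sinN oppr_gt0 => h.
    by rewrite !ltr0_sg.
  + have := pos _ x0; apply: filterS => n h.
    by rewrite !gtr0_sg.
  + by apply: nearW => n; rewrite x0 mulr0 sin0.
Qed.

(** Thresholds increasing to [c] exclude [c] itself, as an open half-line needs. *)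
Let adm_ray l c : adm (fun v => (v l < c)%R%:R).
Proof.
have h : adm (fun v => if v l < c then -1 else 1).
  apply: (@adm_lim (fun n v => Num.sg (v l - (c - n.+1%:R^-1))) _ 1).
  - by move=> n; exact: adm_sg.
  - by move=> n v; rewrite normr_sg; case: (_ != 0).
  - move=> v; apply: cvg_near_cst; case: ltP => vc.
      exists (Num.truncn ((c - v l)^-1)) => // n /= xn.
      rewrite ltr0_sg// subr_lt0 ltrBrDl -ltrBrDr.
      rewrite invf_plt ?posrE ?subr_gt0//.
      by rewrite (lt_le_trans (truncnS_gt _))// ler_nat.
    apply: nearW => n; rewrite gtr0_sg// subr_gt0.
    by apply: lt_le_trans vc; rewrite ltrBlDr ltrDl.
apply: adm_ext (adm_mul (adm_cst 2^-1) (adm_add (adm_cst 1)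
  (adm_mul (adm_cst (-1)) h))) => v.
by case: ifP => _ /=; field.
Qed.

Let adm_eray l (c : \bar R) : adm (fun v => ((v l)%:E < c)%E%:R).
Proof.
case: c => [c||].
- by apply: adm_ext (adm_ray l c) => v; rewrite lte_fin.
- by apply: adm_ext (adm_cst 1) => v; rewrite ltry.
- by apply: adm_ext (adm_cst 0) => v; rewrite ltNge leNye.
Qed.

Hypothesis wave_eq : forall xi t,
  \int[P]_w cos (\sum_i xi i * V i w + t) =
  \int[P']_w cos (\sum_i xi i * V' i w + t).

Let box_eq (c : I -> \bar R) :
  P [set w | forall i, ((V i w)%:E < c i)%E] =
  P' [set w | forall i, ((V' i w)%:E < c i)%E].
Proof.
have e1 : equi (fun=> 1) (fun=> 1).
  split => //; first by exists 1; split=> w; rewrite normr1.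
  move=> xi t.
  under eq_Rintegral do rewrite mulr1.
  under [RHS]eq_Rintegral do rewrite mulr1.
  exact: wave_eq.
have [m m' _ E] := adm_prod (index_enum I) (fun i => adm_eray i (c i)) e1.
have := E (fun=> 0) 0.
have indicE d0 (T0 : measurableType d0) (U : I -> T0 -> R) w :
    cos (lin (fun=> 0) (U^~ w) + 0) * (\prod_i ((U i w)%:E < c i)%E%:R * 1) =
    \1_[set w | forall i, ((U i w)%:E < c i)%E] w.
  rewrite /lin big1 ?addr0 ?cos0 ?mul1r ?mulr1; last by move=> i _; rewrite mul0r.
  rewrite indicE; have [h|h] := boolP (w \in _).
    by rewrite big1// => i _; move: h; rewrite inE => ->.
  have [i hi] : exists i, ~ ((U i w)%:E < c i)%E.
    by apply: contrapT => /forallNP h'; move: h; rewrite notin_setE; apply => i; exact: (contrapT (h' i)).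
  by rewrite (bigD1 i)//= (negbTE (introN idP hi)) mul0r.
under eq_Rintegral do rewrite indicE.
under [X in _ = X -> _]eq_Rintegral do rewrite indicE.
rewrite /Rintegral !integral_indic ?setIT//; [|exact: measurable_box|exact: measurable_box].
move=> h; rewrite -[LHS]fineK ?fin_num_measure//; last exact: measurable_box.
by rewrite h fineK// fin_num_measure//; exact: measurable_box.
Qed.

(** Cramer-Wold: a finite family is determined in law by the cosine averages of its
   linear combinations, because two finite measures that agree on the boxes, which
   are stable under intersection, agree. *)
Lemma law_unique (F : (I -> R) -> R) :
  measurable_fun [set: rvec R I] F ->
  P.-integrable [set: T] (EFin \o (fun w => F (V^~ w))) ->
  P'.-integrable [set: T'] (EFin \o (fun w => F (V'^~ w))) ->
  \int[P]_w F (V^~ w) = \int[P']_w F (V'^~ w).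
Proof.
move=> mF iF iF'.
pose W : {mfun T >-> rvec R I} :=
  mfun_Sub (mem_set (measurable_rvec mV) : (fun w => (V^~ w : rvec R I)) \in mfun).
pose W' : {mfun T' >-> rvec R I} :=
  mfun_Sub (mem_set (measurable_rvec mV') : (fun w => (V'^~ w : rvec R I)) \in mfun).
have E (A : set (rvec R I)) : measurable A ->
    pushforward P W A = pushforward P' W' A.
  move=> mA.
  apply: (@measure_unique _ R (rvec R I) (@boxes R I) (fun=> setT) _ _ _ _
    (pushforward P W) (pushforward P' W')) => //.
  - exact: boxesI.
  - by move=> _; exact: boxesT.
  - by apply/seteqP; split=> // v _; exists 0%N.
  - by move=> _ [c ->]; exact: box_eq.
  - by move=> _; exact: (le_lt_trans (probability_le1 P measurableT) (ltry 1)).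
rewrite /Rintegral; congr fine.
have mF' : measurable_fun [set: rvec R I] (EFin \o F) by exact/measurable_EFinP.
transitivity (\int[pushforward P W]_v (F v)%:E)%E.
  by rewrite integral_pushforward.
transitivity (\int[pushforward P' W']_v (F v)%:E)%E.
  by apply: eq_measure_integral => A mA _; exact: E.
by rewrite integral_pushforward.
Qed.

End law_uniqueness.

(** * Product spaces and centered Gaussian families *)

(** The product measure, packaged as a probability measure so that the
   integrability lemmas apply to it directly. *)
Definition prodP (R : realType) d1 (T1 : measurableType d1)
  (P1 : probability T1 R) d2 (T2 : measurableType d2) (P2 : probability T2 R) :
  probability (T1 * T2)%type R := (P1 \x P2)%E.

Section real_fubini.
Context (R : realType) d1 (T1 : measurableType d1) (P1 : probability T1 R)
        d2 (T2 : measurableType d2) (P2 : probability T2 R).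

Lemma rint_fst (f : T1 -> R) : P1.-integrable [set: T1] (EFin \o f) ->
  (prodP P1 P2).-integrable [set: T1 * T2] (EFin \o (fun z => f z.1)).
Proof.
move=> fi; have mf := rint_measurable fi.
have mf1 : measurable_fun [set: T1 * T2] (EFin \o (fun z : T1 * T2 => f z.1)).
  by apply/measurable_EFinP; apply: (measurableT_comp mf); exact: measurable_fst.
apply/(integrable12ltyP P1 P2 mf1).
have /integrableP[_] := fi; apply: le_lt_trans.
apply: ge0_le_integral => //.
- move=> x _; exact: integral_ge0.
- apply: (measurable_fun_fubini_tonelli_F (abse \o (EFin \o (fun z : T1 * T2 => f z.1)))) => //=.
  exact: measurableT_comp.
- by apply: measurableT_comp => //; exact/measurable_EFinP.
- move=> x _; rewrite /= integral_cst//.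
  apply: (le_trans (lee_wpmul2l _ (probability_le1 P2 measurableT))) => //.
  by rewrite mule1.
Qed.

Lemma rint_snd (f : T2 -> R) : P2.-integrable [set: T2] (EFin \o f) ->
  (prodP P1 P2).-integrable [set: T1 * T2] (EFin \o (fun z => f z.2)).
Proof.
move=> fi; have mf := rint_measurable fi.
have mf1 : measurable_fun [set: T1 * T2] (EFin \o (fun z : T1 * T2 => f z.2)).
  by apply/measurable_EFinP; apply: (measurableT_comp mf); exact: measurable_snd.
apply/(integrable21ltyP P1 P2 mf1).
have /integrableP[_] := fi; apply: le_lt_trans.
apply: ge0_le_integral => //.
- move=> x _; exact: integral_ge0.
- apply: (measurable_fun_fubini_tonelli_G (abse \o (EFin \o (fun z : T1 * T2 => f z.2)))) => //=.
  exact: measurableT_comp.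
- by apply: measurableT_comp => //; exact/measurable_EFinP.
- move=> x _; rewrite /= integral_cst//.
  apply: (le_trans (lee_wpmul2l _ (probability_le1 P1 measurableT))) => //.
  by rewrite mule1.
Qed.

Lemma Rint_prod (f : T1 * T2 -> R) :
  (prodP P1 P2).-integrable [set: T1 * T2] (EFin \o f) ->
  (forall x, P2.-integrable [set: T2] (EFin \o (fun y => f (x, y)))) ->
  P1.-integrable [set: T1] (EFin \o (fun x => \int[P2]_y f (x, y))) /\
  \int[prodP P1 P2]_z f z = \int[P1]_x \int[P2]_y f (x, y).
Proof.
move=> fi fxi.
have E x : fubini_F P2 (EFin \o f) x = (\int[P2]_y f (x, y))%:E.
  by rewrite /fubini_F -Rint_EFin.
split.
  apply: (eq_integrable measurableT _ _ _ (integrable_fubini_F fi)) => x _.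
  by rewrite E.
rewrite /Rintegral -integral12_prod_meas1//; congr fine.
apply: eq_integral => x _; rewrite E; by [].
Qed.

End real_fubini.

(** The variable integrated first sees [U] as a phase and contributes the factor
   [k] whatever that phase is. *)
Lemma wave_prod (R : realType) d1 (T1 : measurableType d1) (P1 : probability T1 R)
  d2 (T2 : measurableType d2) (P2 : probability T2 R) (U : T1 -> R) (Z : T2 -> R)
  (k : R) : measurable_fun [set: T1] U -> measurable_fun [set: T2] Z ->
  (forall t, \int[P2]_y cos (Z y + t) = cos t * k) ->
  \int[prodP P1 P2]_z cos (U z.1 + Z z.2) = k * \int[P1]_x cos (U x).
Proof.
move=> mU mZ Ek.
have mcos : measurable_fun [set: R] (@cos R).
  by apply: continuous_measurable_fun; exact: continuous_cos.
have mU1 : measurable_fun [set: T1 * T2] (fun z => U z.1).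
  by apply: (measurableT_comp mU); exact: measurable_fst.
have mZ2 : measurable_fun [set: T1 * T2] (fun z => Z z.2).
  by apply: (measurableT_comp mZ); exact: measurable_snd.
have [] := @Rint_prod _ _ _ P1 _ _ P2 (fun z => cos (U z.1 + Z z.2)).
- apply: (@rint_bounded _ _ _ _ _ 1) => [|z]; last exact: cos_max.
  by apply: (measurableT_comp mcos); exact: measurable_funD.
- move=> x; apply: (@rint_bounded _ _ _ _ _ 1) => [|z]; last exact: cos_max.
  by apply: (measurableT_comp mcos) => /=; apply: measurable_funD.
move=> _ ->; rewrite -RintZ; last first.
  apply: (@rint_bounded _ _ _ _ _ 1) => [|z]; last exact: cos_max.
  exact: (measurableT_comp mcos mU).
apply: eq_Rintegral => x _ /=.
under eq_Rintegral do rewrite addrC.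
by rewrite Ek mulrC.
Qed.

Section centered_gaussian.
Context (R : realType) (I : finType) d (T : measurableType d) (P : probability T R).

(** Gaussianity enters the interpolation only through these consequences; [s] is
   the standard deviation of the linear combination with coefficients [xi]. *)
Definition centered_gaussian (x : I -> T -> R) : Prop :=
  [/\ forall i, measurable_fun [set: T] (x i),
      forall i, P.-integrable [set: T] (EFin \o (fun w => `|x i w| ^+ 3)),
      forall i, \int[P]_w x i w = 0 &
      forall xi : I -> R, exists s, forall a t,
        \int[P]_w cos (a * (\sum_i xi i * x i w) + t) =
        cos t * expR (- (a ^+ 2 * s ^+ 2 / 2))].

Lemma rint_cube_le (f : T -> R) (p : nat) : (p <= 3)%N ->
  measurable_fun [set: T] f ->
  P.-integrable [set: T] (EFin \o (fun w => `|f w| ^+ 3)) ->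
  P.-integrable [set: T] (EFin \o (fun w => f w ^+ p)).
Proof.
move=> p3 mf fi; apply: (@rint_le _ _ _ _ _ (fun w => 1 + `|f w| ^+ 3)).
- exact: measurable_funX.
- move=> w; rewrite normrX; set r := `|_|; have r0 : 0 <= r by exact: normr_ge0.
  have [r1|/ltW r1] := leP r 1.
    by rewrite (le_trans (exprn_ile1 _ _ r1))// lerDl exprn_ge0.
  by apply: (@le_trans _ _ (r ^+ 3)); [exact: ler_weXn2l|rewrite lerDr].
- by apply: rintD => //; exact: rint_cst.
Qed.

Lemma centered_gaussian_int x i : centered_gaussian x ->
  P.-integrable [set: T] (EFin \o x i).
Proof. by move=> [mx x3 _ _]; exact: (@rint_cube_le (x i) 1). Qed.

Lemma centered_gaussian_sqr x i j : centered_gaussian x ->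
  P.-integrable [set: T] (EFin \o (fun w => (x i w - x j w) ^+ 2)).
Proof.
move=> [mx x3 _ _].
apply: (@rint_le _ _ _ _ _ (fun w => 2 * (x i w ^+ 2 + x j w ^+ 2))).
- by apply: measurable_funX; exact: measurable_funB.
- move=> w; rewrite ger0_norm ?sqr_ge0//.
  by have := sqr_ge0 (x i w + x j w); nra.
- by apply: rintZ; apply: rintD; exact: (@rint_cube_le _ 2).
Qed.

(** The location parameter of a linear combination is its mean, which is linear, so
   centering the entries centers all combinations. *)
Lemma gaussian_centered (X : I -> T -> R) :
  (forall i, measurable_fun [set: T] (X i)) ->
  (forall a : I -> R, is_gaussian P (fun w => \sum_i a i * X i w)) ->
  (forall i, P.-integrable [set: T] (EFin \o X i)) /\
  centered_gaussian (fun i w => X i w - \int[P]_u X i u).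
Proof.
move=> mX gX.
have mZ a : measurable_fun [set: T] (fun w => \sum_i a i * X i w).
  by apply: measurable_sum => i; exact: measurable_funM.
have shift (Z : T -> R) mu : measurable_fun [set: T] Z ->
    P.-integrable [set: T] (EFin \o (fun w => `|Z w - mu| ^+ 3)) ->
    \int[P]_w (Z w - mu) = 0 ->
    P.-integrable [set: T] (EFin \o Z) /\ mu = \int[P]_w Z w.
  move=> mZ0 Z3 Z0.
  have iZm : P.-integrable [set: T] (EFin \o (fun w => Z w - mu)).
    by apply: (@rint_cube_le _ 1) => //; exact: measurable_funB.
  have iZ : P.-integrable [set: T] (EFin \o Z).
    rewrite (_ : Z = fun w => (Z w - mu) + mu); last by apply/funext => w; rewrite subrK.
    by apply: rintD => //; exact: rint_cst.
  split=> //; apply/esym/eqP; rewrite -subr_eq0 -Z0 RintB ?Rint_cst//.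
  exact: rint_cst.
have Xi i : (fun w => \sum_j (j == i)%:R * X j w) = X i.
  apply/funext => w; rewrite (bigD1 i)//= eqxx mul1r big1 ?addr0//.
  by move=> j /negbTE ->; rewrite mul0r.
have one i : P.-integrable [set: T] (EFin \o X i) /\
    P.-integrable [set: T] (EFin \o (fun w => `|X i w - \int[P]_u X i u| ^+ 3)).
  have [mu [s [Z3 Z0 _]]] := gaussian_facts (mZ _) (gX (fun j => (j == i)%:R)).
  move: Z3 Z0; under eq_fun do rewrite (congr1 (fun f => f _) (Xi i)).
  move=> Z3; under eq_Rintegral do rewrite (congr1 (fun f => f _) (Xi i)).
  by move=> Z0; have [iX <-] := shift _ _ (mX i) Z3 Z0.
split=> [i|]; first by have [] := one i.
split.
- by move=> i; exact: measurable_funB.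
- by move=> i; have [] := one i.
- move=> i; rewrite RintB ?Rint_cst ?subrr//; last exact: rint_cst.
  by have [] := one i.
- move=> xi.
  have [mu [s [Z3 Z0 Zcos]]] := gaussian_facts (mZ _) (gX xi).
  have [_ muE] := shift _ _ (mZ xi) Z3 Z0.
  exists s => a t; rewrite -Zcos; apply: eq_Rintegral => w _.
  congr (cos (_ * _ + _)); rewrite muE Rint_sum.
    rewrite -sumrB; apply: eq_bigr => i _.
    by rewrite RintZ ?mulrBr//; have [] := one i.
  by move=> i; apply: rintZ; have [] := one i.
Qed.

End centered_gaussian.

(** * Comparison of expectations along a Gaussian interpolation *)

Section comparison.
Context (R : realType) (I : finType) d (T : measurableType d) (P : probability T R).
Variables (x y : I -> T -> R).
Hypotheses (gx : centered_gaussian P x) (gy : centered_gaussian P y).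
Variables (F : (I -> R) -> R) (mu : I -> R).
Hypothesis mF : measurable_fun [set: rvec R I] F.
Variables A B : R.
Hypothesis F_growth : forall v, `|F v| <= A + B * \sum_i `|v i|.

Let ix i : P.-integrable [set: T] (EFin \o x i). Proof. exact: centered_gaussian_int. Qed.
Let iy i : P.-integrable [set: T] (EFin \o y i). Proof. exact: centered_gaussian_int. Qed.

Lemma growth_int d0 (T0 : measurableType d0) (P0 : probability T0 R) (U : I -> T0 -> R) :
  (forall i, P0.-integrable [set: T0] (EFin \o U i)) ->
  P0.-integrable [set: T0] (EFin \o (fun w => F (U^~ w))).
Proof.
move=> iU; apply: (@rint_le _ _ _ _ _ (fun w => A + B * \sum_i `|U i w|)).
- apply: (measurableT_comp mF); apply: measurable_rvec => i.
  exact: rint_measurable (iU i).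
- by move=> w; exact: F_growth.
- apply: rintD; first exact: rint_cst.
  by apply: rintZ; apply: rint_sum => i; exact: rint_norm.
Qed.

Let wave_lin (z : I -> T -> R) xi a t s :
  (forall a t, \int[P]_w cos (a * (\sum_i xi i * z i w) + t) =
        cos t * expR (- (a ^+ 2 * s ^+ 2 / 2))) ->
  \int[P]_w cos (\sum_i xi i * (a * z i w) + t) =
  cos t * expR (- (a ^+ 2 * s ^+ 2 / 2)).
Proof.
move=> <-; apply: eq_Rintegral => w _; congr (cos (_ + _)).
by rewrite mulr_sumr; apply: eq_bigr => i _; rewrite mulrCA.
Qed.

(** [x] and [y] live on the same space and may be dependent; reading them on two
   factors of a product makes them independent. *)
Let W (s t : R) (z : T * T) i : R := mu i + (Num.sqrt s * x i z.1 + Num.sqrt t * y i z.2).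

Let iW s t i : (prodP P P).-integrable [set: T * T] (EFin \o (fun z => W s t z i)).
Proof.
apply: rintD; first exact: rint_cst.
apply: rintD; apply: rintZ; [exact: (rint_fst P (ix i))|exact: (rint_snd P (iy i))].
Qed.

Let G s t := \int[prodP P P]_z F (W s t z).

Let mlin d0 (T0 : measurableType d0) (P0 : probability T0 R) (U : I -> T0 -> R) (xi : I -> R) t :
  (forall i, P0.-integrable [set: T0] (EFin \o U i)) ->
  measurable_fun [set: T0] (fun w => \sum_i xi i * U i w + t).
Proof.
move=> iU; apply: measurable_funD => //; apply: measurable_sum => i.
by apply: measurable_funM => //; exact: rint_measurable (iU i).
Qed.

Let mlin0 d0 (T0 : measurableType d0) (P0 : probability T0 R) (U : I -> T0 -> R) (xi : I -> R) :
  (forall i, P0.-integrable [set: T0] (EFin \o U i)) ->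
  measurable_fun [set: T0] (fun w => \sum_i xi i * U i w).
Proof.
move=> iU; apply: measurable_sum => i.
by apply: measurable_funM => //; exact: rint_measurable (iU i).
Qed.

Let wave2 s t xi th rx ry : 0 <= s -> 0 <= t ->
  (forall a t, \int[P]_w cos (a * (\sum_i xi i * x i w) + t) =
        cos t * expR (- (a ^+ 2 * rx ^+ 2 / 2))) ->
  (forall a t, \int[P]_w cos (a * (\sum_i xi i * y i w) + t) =
        cos t * expR (- (a ^+ 2 * ry ^+ 2 / 2))) ->
  \int[prodP P P]_z cos (\sum_i xi i * W s t z i + th) =
  cos (\sum_i xi i * mu i + th) * expR (- (s * rx ^+ 2 / 2)) * expR (- (t * ry ^+ 2 / 2)).
Proof.
move=> s0 t0 Ex Ey.
have E z : cos (\sum_i xi i * W s t z i + th) =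
    cos ((\sum_i xi i * (Num.sqrt s * x i z.1) + (\sum_i xi i * mu i + th)) +
         \sum_i xi i * (Num.sqrt t * y i z.2)).
  have -> : \sum_i xi i * W s t z i = \sum_i xi i * mu i +
      (\sum_i xi i * (Num.sqrt s * x i z.1) + \sum_i xi i * (Num.sqrt t * y i z.2)).
    by rewrite -!big_split/=; apply: eq_bigr => i _; rewrite /W; ring.
  by congr cos; ring.
under eq_Rintegral do rewrite E.
rewrite (@wave_prod _ _ _ P _ _ P
  (fun w => \sum_i xi i * (Num.sqrt s * x i w) + (\sum_i xi i * mu i + th))
  (fun w => \sum_i xi i * (Num.sqrt t * y i w)) (expR (- (t * ry ^+ 2 / 2)))).
- by rewrite (wave_lin _ _ Ex) mulrC sqr_sqrtr.
- by apply: (mlin (P0 := P)) => i; exact: rintZ.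
- by apply: (mlin0 (P0 := P)) => i; exact: rintZ.
- by move=> u; rewrite (wave_lin _ _ Ey) sqr_sqrtr.
Qed.

Let wave3 s t h xi th rx ry r (u : I -> T -> R) : 0 <= s -> 0 <= t -> 0 <= h ->
  (forall i, P.-integrable [set: T] (EFin \o u i)) ->
  (forall a t, \int[P]_w cos (a * (\sum_i xi i * x i w) + t) =
        cos t * expR (- (a ^+ 2 * rx ^+ 2 / 2))) ->
  (forall a t, \int[P]_w cos (a * (\sum_i xi i * y i w) + t) =
        cos t * expR (- (a ^+ 2 * ry ^+ 2 / 2))) ->
  (forall a t, \int[P]_w cos (a * (\sum_i xi i * u i w) + t) =
        cos t * expR (- (a ^+ 2 * r ^+ 2 / 2))) ->
  \int[prodP (prodP P P) P]_z
     cos (\sum_i xi i * (W s t z.1 i + Num.sqrt h * u i z.2) + th) =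
  cos (\sum_i xi i * mu i + th) * expR (- (s * rx ^+ 2 / 2)) *
     expR (- (t * ry ^+ 2 / 2)) * expR (- (h * r ^+ 2 / 2)).
Proof.
move=> s0 t0 h0 iu Ex Ey Eu.
have E z : cos (\sum_i xi i * (W s t z.1 i + Num.sqrt h * u i z.2) + th) =
    cos ((\sum_i xi i * W s t z.1 i + th) + \sum_i xi i * (Num.sqrt h * u i z.2)).
  congr cos; rewrite addrAC -big_split/=; congr (_ + _).
  by apply: eq_bigr => i _; rewrite mulrDr.
under eq_Rintegral do rewrite E.
rewrite (@wave_prod _ _ _ (prodP P P) _ _ P
  (fun w => \sum_i xi i * W s t w i + th)
  (fun w => \sum_i xi i * (Num.sqrt h * u i w)) (expR (- (h * r ^+ 2 / 2)))).
- by rewrite (wave2 _ s0 t0 Ex Ey) mulrC.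
- by apply: (mlin (P0 := prodP P P) (U := fun i z => W s t z i)) => i; exact: iW.
- by apply: (mlin0 (P0 := P)) => i; exact: rintZ.
- by move=> v; rewrite (wave_lin _ _ Eu) sqr_sqrtr.
Qed.

Let iW3 s t h (u : I -> T -> R) i : (forall i, P.-integrable [set: T] (EFin \o u i)) ->
  (prodP (prodP P P) P).-integrable [set: T * T * T]
    (EFin \o (fun z => W s t z.1 i + Num.sqrt h * u i z.2)).
Proof.
move=> iu; apply: rintD; first exact: (rint_fst P (iW s t i)).
by apply: rintZ; exact: (rint_snd (prodP P P) (iu i)).
Qed.

(** A point of variances [(s', t')] may be replaced by one of variances [(s, t)] plus
   an independent increment, once the cosine averages agree. *)
Let split_gen s t h s' t' (u : I -> T -> R) :
  (forall i, P.-integrable [set: T] (EFin \o u i)) ->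
  (forall xi th, \int[prodP P P]_z cos (\sum_i xi i * W s' t' z i + th) =
    \int[prodP (prodP P P) P]_z
     cos (\sum_i xi i * (W s t z.1 i + Num.sqrt h * u i z.2) + th)) ->
  (prodP P P).-integrable [set: T * T]
    (EFin \o (fun z => \int[P]_w F (fun i => W s t z i + Num.sqrt h * u i w))) /\
  G s' t' =
  \int[prodP P P]_z \int[P]_w F (fun i => W s t z i + Num.sqrt h * u i w).
Proof.
move=> iu E.
have [i1 <-] := @Rint_prod _ _ _ (prodP P P) _ _ P
   (fun z => F (fun i => W s t z.1 i + Num.sqrt h * u i z.2))
   (growth_int (fun i => iW3 s t h i iu))
   (fun z => growth_int (P0 := P) (U := fun i w => W s t z i + Num.sqrt h * u i w)
     (fun i => rintD (rint_cst _ _) (rintZ _ (iu i)))).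
split=> //.
apply: (@law_unique R I _ _ (prodP P P) _ _ (prodP (prodP P P) P)
  (fun i z => W s' t' z i) (fun i z => W s t z.1 i + Num.sqrt h * u i z.2)) => //.
- by move=> i; exact: (rint_measurable (iW s' t' i)).
- by move=> i; exact: (rint_measurable (iW3 s t h i iu)).
- exact: (growth_int (U := fun i z => W s' t' z i)).
- apply: (growth_int (P0 := prodP (prodP P P) P)
    (U := fun i z => W s t z.1 i + Num.sqrt h * u i z.2)) => i; exact: iW3.
Qed.

Let split_x s t h : 0 <= s -> 0 <= t -> 0 <= h ->
  (prodP P P).-integrable [set: T * T]
    (EFin \o (fun z => \int[P]_w F (fun i => W s t z i + Num.sqrt h * x i w))) /\
  G (s + h) t =
  \int[prodP P P]_z \int[P]_w F (fun i => W s t z i + Num.sqrt h * x i w).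
Proof.
move=> s0 t0 h0; apply: split_gen => // xi th.
have [_ _ _ /(_ xi)[rx Ex]] := gx; have [_ _ _ /(_ xi)[ry Ey]] := gy.
rewrite (wave3 _ s0 t0 h0 _ Ex Ey Ex)// (wave2 _ _ t0 Ex Ey) ?addr_ge0//.
have -> : expR (- ((s + h) * rx ^+ 2 / 2)) =
    expR (- (s * rx ^+ 2 / 2)) * expR (- (h * rx ^+ 2 / 2)).
  by rewrite -expRD; congr expR; field.
ring.
Qed.

Let split_y s t h : 0 <= s -> 0 <= t -> 0 <= h ->
  (prodP P P).-integrable [set: T * T]
    (EFin \o (fun z => \int[P]_w F (fun i => W s t z i + Num.sqrt h * y i w))) /\
  G s (t + h) =
  \int[prodP P P]_z \int[P]_w F (fun i => W s t z i + Num.sqrt h * y i w).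
Proof.
move=> s0 t0 h0; apply: split_gen => // xi th.
have [_ _ _ /(_ xi)[rx Ex]] := gx; have [_ _ _ /(_ xi)[ry Ey]] := gy.
rewrite (wave3 _ s0 t0 h0 _ Ex Ey Ey)// (wave2 _ s0 _ Ex Ey) ?addr_ge0//.
have -> : expR (- ((t + h) * ry ^+ 2 / 2)) =
    expR (- (t * ry ^+ 2 / 2)) * expR (- (h * ry ^+ 2 / 2)).
  by rewrite -expRD; congr expR; field.
ring.
Qed.

Variables (C : R) (g : (I -> R) -> I -> R) (M : (I -> R) -> I -> I -> R).
Hypothesis C_ge0 : 0 <= C.
Hypothesis taylor : forall v z : I -> R,
  `|F (fun i => v i + z i) - F v - \sum_i g v i * z i
    + 4^-1 * \sum_i \sum_j M v i j * (z i - z j) ^+ 2| <= C * \sum_i `|z i| ^+ 3.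
Variable K : R.
Hypothesis M_K : forall v, 4^-1 * \sum_i \sum_j M v i j *
  (\int[P]_w (y i w - y j w) ^+ 2 - \int[P]_w (x i w - x j w) ^+ 2) <= K.

Let quad (u : I -> T -> R) v :=
  4^-1 * \sum_i \sum_j M v i j * \int[P]_w (u i w - u j w) ^+ 2.
Let cube (u : I -> T -> R) := C * \sum_i \int[P]_w `|u i w| ^+ 3.

(** The linear term averages to zero, and the quadratic one to the increments. *)
Let one_step (u : I -> T -> R) v h : centered_gaussian P u -> 0 <= h ->
  `|\int[P]_w F (fun i => v i + Num.sqrt h * u i w) - F v + h * quad u v| <=
  h * Num.sqrt h * cube u.
Proof.
move=> gu h0; have [mu' iu3 u0 _] := gu.
have iu i := centered_gaussian_int i gu.
have iq i j := centered_gaussian_sqr i j gu.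
have sh0 := sqrtr_ge0 h; have sh2 := sqr_sqrtr h0.
have iFu : P.-integrable [set: T] (EFin \o (fun w => F (fun i => v i + Num.sqrt h * u i w))).
  apply: (growth_int (U := fun i w => v i + Num.sqrt h * u i w)) => i.
  by apply: rintD; [exact: rint_cst|exact: rintZ].
have i1 : P.-integrable [set: T] (EFin \o (fun w => F (fun i => v i + Num.sqrt h * u i w) - F v)).
  by apply: rintB => //; exact: rint_cst.
have iL : P.-integrable [set: T] (EFin \o (fun w => \sum_i g v i * Num.sqrt h * u i w)).
  by apply: rint_sum => i; exact: rintZ.
have iQ : P.-integrable [set: T] (EFin \o (fun w => \sum_i \sum_j M v i j * h * (u i w - u j w) ^+ 2)).
  by apply: rint_sum => i; apply: rint_sum => j; exact: rintZ.
have i12 : P.-integrable [set: T] (EFin \o (fun w => F (fun i => v i + Num.sqrt h * u i w) - F v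
   - \sum_i g v i * Num.sqrt h * u i w)) by exact: rintB.
have i123 : P.-integrable [set: T] (EFin \o (fun w => F (fun i => v i + Num.sqrt h * u i w) - F v
   - \sum_i g v i * Num.sqrt h * u i w
   + 4^-1 * \sum_i \sum_j M v i j * h * (u i w - u j w) ^+ 2)).
  by apply: rintD => //; exact: rintZ.
have -> : \int[P]_w F (fun i => v i + Num.sqrt h * u i w) - F v + h * quad u v =
  \int[P]_w (F (fun i => v i + Num.sqrt h * u i w) - F v
   - \sum_i g v i * Num.sqrt h * u i w
   + 4^-1 * \sum_i \sum_j M v i j * h * (u i w - u j w) ^+ 2).
  rewrite RintD//; last exact: rintZ.
  rewrite RintB// RintB//; last exact: rint_cst.
  rewrite Rint_cst RintZ// Rint_sum; last by move=> i; exact: rintZ.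
  rewrite big1 ?subr0; last by move=> i _; rewrite RintZ// u0 mulr0.
  rewrite Rint_sum; last by move=> i; apply: rint_sum => j; exact: rintZ.
  congr (_ + _); rewrite /quad mulrCA; congr (_ * _).
  rewrite mulr_sumr; apply: eq_bigr => i _.
  rewrite Rint_sum; last by move=> j; exact: rintZ.
  by rewrite mulr_sumr; apply: eq_bigr => j _; rewrite RintZ// mulrCA mulrA.
apply: (le_trans (le_normr_Rintegral _ _)) => //.
have -> : h * Num.sqrt h * cube u =
  \int[P]_w (C * \sum_i h * Num.sqrt h * `|u i w| ^+ 3).
  rewrite RintZ; last by apply: rint_sum => i; exact: rintZ.
  rewrite Rint_sum; last by move=> i; exact: rintZ.
  rewrite /cube mulrCA; congr (_ * _); rewrite mulr_sumr; apply: eq_bigr => i _.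
  by rewrite RintZ.
apply: Rint_le.
- exact: (rint_norm i123).
- by apply: rintZ; apply: rint_sum => i; exact: rintZ.
- move=> w; apply: le_trans (le_trans (taylor v (fun i => Num.sqrt h * u i w)) _).
    rewrite le_eqVlt; apply/orP; left; apply/eqP; congr `|_ - _ + _ * _|.
      by apply: eq_bigr => i _; rewrite mulrA.
    apply: eq_bigr => i _; apply: eq_bigr => j _.
    rewrite (_ : Num.sqrt h * u i w - Num.sqrt h * u j w = Num.sqrt h * (u i w - u j w)); last by ring.
    by rewrite exprMn sh2; ring.
  rewrite ler_wpM2l//; apply: ler_sum => i _.
  by rewrite normrM (ger0_norm sh0) exprMn exprS sh2 (mulrC (Num.sqrt h)).
Qed.

(** Both sides add an independent increment of variance [h] to the same random
   point, so the difference can be estimated pointwise. *)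
Let step s t h : 0 <= s -> 0 <= t -> 0 <= h ->
  G (s + h) t - G s (t + h) <= h * K + h * Num.sqrt h * (cube x + cube y).
Proof.
move=> s0 t0 h0.
have [ix3 ->] := split_x s0 t0 h0; have [iy3 ->] := split_y s0 t0 h0.
rewrite -RintB// -[leRHS](@Rint_cst _ _ _ (prodP P P)).
apply: Rint_le => [||z]; [exact: rintB|exact: rint_cst|].
have := one_step (W s t z) gx h0; have := one_step (W s t z) gy h0.
have := M_K (W s t z) => MK.
have : quad y (W s t z) - quad x (W s t z) <= K.
  apply: le_trans MK; rewrite /quad -mulrBr le_eqVlt; apply/orP; left; apply/eqP.
  congr (_ * _); rewrite -sumrB; apply: eq_bigr => i _.
  by rewrite -sumrB; apply: eq_bigr => j _; rewrite mulrBr.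
move=> q; have {}q := ler_wpM2l h0 q.
rewrite !ler_norml => /andP[hy _] /andP[_ hx].
rewrite mulrBr in q; rewrite mulrDr; move: hy hx q => /=.
move: (\int[P]_w F _) (\int[P]_w F _) => a b hy hx q; lra.
Qed.

Let telescoped (N j : nat) : (j <= N.+1)%N ->
  G (j%:R / N.+1%:R) ((N.+1 - j)%:R / N.+1%:R) - G 0 1 <=
  j%:R * (N.+1%:R^-1 * K + N.+1%:R^-1 * Num.sqrt N.+1%:R^-1 * (cube x + cube y)).
Proof.
have N0 : N.+1%:R != 0 :> R by [].
elim: j => [|j IH] jN.
  by rewrite subn0 !mul0r divff// subrr.
have := IH (ltnW jN).
have := @step (j%:R / N.+1%:R) ((N.+1 - j.+1)%:R / N.+1%:R) N.+1%:R^-1.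
rewrite !divr_ge0// invr_ge0 => /(_ isT isT (ler0n _ _)).
have -> : j%:R / N.+1%:R + N.+1%:R^-1 = j.+1%:R / N.+1%:R :> R.
  by rewrite -[j.+1%:R]natr1 mulrDl mul1r.
have -> : (N.+1 - j.+1)%:R / N.+1%:R + N.+1%:R^-1 = (N.+1 - j)%:R / N.+1%:R :> R.
  by rewrite -(subnSK jN) -[(N.+1 - j.+1).+1%:R]natr1 mulrDl mul1r.
move=> h1 h2.
rewrite -[j.+1%:R in leRHS]natr1 mulrDl mul1r.
by rewrite [leRHS]addrC; have := lerD h1 h2; rewrite addrA subrK.
Qed.

(** The errors of order [h sqrt h] vanish in the limit of [1 / h] steps. *)
Theorem gaussian_comparison :
  \int[P]_w F (fun i => mu i + x i w) - \int[P]_w F (fun i => mu i + y i w) <= K.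
Proof.
have E1 : G 1 0 = \int[P]_w F (fun i => mu i + x i w).
  rewrite /G (_ : (fun z => F _) = fun z : T * T => F (fun i => mu i + x i z.1)).
    have iF := growth_int (U := fun i w => mu i + x i w)
       (fun i => rintD (rint_cst P (mu i)) (ix i)).
    have [] := @Rint_prod _ _ _ P _ _ P (fun z : T * T => F (fun i => mu i + x i z.1)).
    - exact: (rint_fst P iF).
    - by move=> w; exact: (rint_cst P (F (fun i => mu i + x i w))).
    by move=> _ ->; apply: eq_Rintegral => w _; exact: (Rint_cst P (F (fun i => mu i + x i w))).
  apply/funext => z; congr F; apply/funext => i.
  by rewrite /W sqrtr1 sqrtr0 mul0r addr0 mul1r.
have E0 : G 0 1 = \int[P]_w F (fun i => mu i + y i w).
  rewrite /G (_ : (fun z => F _) = fun z : T * T => F (fun i => mu i + y i z.2)).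
    have iF := growth_int (U := fun i w => mu i + y i w)
       (fun i => rintD (rint_cst P (mu i)) (iy i)).
    have [] := @Rint_prod _ _ _ P _ _ P (fun z : T * T => F (fun i => mu i + y i z.2)).
    - exact: (rint_snd P iF).
    - by move=> w.
    by move=> _ ->; exact: (Rint_cst P (\int[P]_w F (fun i => mu i + y i w))).
  apply/funext => z; congr F; apply/funext => i.
  by rewrite /W sqrtr1 sqrtr0 mul0r add0r mul1r.
rewrite -E1 -E0.
have bound N : G 1 0 - G 0 1 <= K + Num.sqrt N.+1%:R^-1 * (cube x + cube y).
  have N0 : N.+1%:R != 0 :> R by [].
  have := @telescoped N N.+1 (leqnn _).
  by rewrite subnn mul0r divff// -mulrA -mulrDr mulrA divff// mul1r.
have c : K + Num.sqrt N.+1%:R^-1 * (cube x + cube y) @[N --> \oo] --> K.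
  rewrite -[X in _ --> X]addr0; apply: cvgD; first exact: cvg_cst.
  rewrite -[X in _ --> X](mul0r (cube x + cube y)); apply: cvgM; last exact: cvg_cst.
  rewrite -(@sqrtr0 R).
  apply: (cvg_comp (@harmonic R) (@Num.sqrt R)); first exact: cvg_harmonic.
  exact: sqrt_continuous.
by rewrite -(cvg_lim (@Rhausdorff R) c); apply: limr_ge; [apply/cvg_ex; exists K|exact: nearW].
Qed.

End comparison.

(** * Elementary symmetric sums and negative correlation *)

Section elementary_symmetric.
Variable R : realFieldType.

(** Log-concavity without internal zeros, in the cross-multiplied form that
   is stable under products by linear factors. *)
Definition log_concave (a : nat -> R) : Prop :=
  (forall i, 0 <= a i) /\
  forall i j, (i <= j)%N -> a i * a j.+2 <= a i.+1 * a j.+1.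

(** The coefficient of [w] is the only delicate one: for [i < j] it follows from two
   consecutive instances of log-concavity. *)
Lemma log_concave_mul1X (a b : nat -> R) (w : R) : 0 <= w -> log_concave a ->
  b 0%N = a 0%N -> (forall i, b i.+1 = a i.+1 + w * a i) -> log_concave b.
Proof.
move=> w0 [a0 ac] b0 bS; split=> [[|i]|i j ij].
- by rewrite b0.
- by rewrite bS addr_ge0// mulr_ge0.
have step x y z : 0 <= w * (y - x) -> 0 <= w * (z - y) -> 0 <= w * (z - x).
  by move=> h1 h2; lra.
have acw u v : (u <= v)%N -> 0 <= w * (a u.+1 * a v.+1 - a u * a v.+2).
  by move=> uv; rewrite mulr_ge0// subr_ge0 ac.
case: i ij => [|i] ij.
  rewrite b0 !bS; have h0 := ac 0%N j isT.
  have h1 : 0 <= w * (a 1%N * a j.+1).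
    by rewrite !mulr_ge0.
  case: j ij h0 h1 => [|j] ij h0 h1.
    have := mulr_ge0 (mulr_ge0 w0 w0) (mulr_ge0 (a0 0%N) (a0 0%N)).
    have := mulr_ge0 w0 (mulr_ge0 (a0 0%N) (a0 1%N)). nra.
  have := mulr_ge0 w0 (mulr_ge0 (a0 1%N) (a0 j.+1)).
  have := mulr_ge0 (mulr_ge0 w0 w0) (mulr_ge0 (a0 0%N) (a0 j.+1)); lra.
case: j ij => [//|j] ij; rewrite !bS.
have h0 := ac _ _ ij.
have h2 : 0 <= w ^+ 2 * (a i.+1 * a j.+1 - a i * a j.+2).
  by rewrite mulr_ge0 ?sqr_ge0// subr_ge0 ac.
have h1 : 0 <= w * (a i.+2 * a j.+1 - a i * a j.+3).
  have k1 := acw i j.+1 (leqW ij).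
  have [ij'|ij'] := eqVneq i j; first by move: k1; rewrite ij' (mulrC (a j.+1)).
  apply: step k1 _; apply: acw; rewrite ltn_neqAle ij'; exact: ij.
nra.
Qed.

Variable m : nat.
Implicit Types (w : 'I_m -> R) (S : {set 'I_m}).

Lemma sum_prod_coef w k :
  \sum_(S : {set 'I_m} | #|S| == k) \prod_(j in S) w j = (\prod_j (1 + w j *: 'X))`_k.
Proof.
have -> : \prod_j (1 + w j *: 'X) = \sum_(S : {set 'I_m}) (\prod_(j in S) w j) *: 'X^#|S|.
  under eq_bigr do rewrite addrC.
  rewrite bigA_distr; apply: eq_bigr => S _.
  rewrite (bigID (mem S))/= [X in _ * X]big1 ?mulr1; last first.
    by move=> i /negbTE ->.
  rewrite (eq_bigr (fun i => w i *: 'X)); last by move=> i ->.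
  by rewrite scaler_prod prodr_const.
rewrite coef_sum [LHS]big_mkcond/=; apply: eq_bigr => S _.
by rewrite coefZ coefXn eq_sym; case: ifP; rewrite ?mulr1 ?mulr0.
Qed.

Lemma coef_mul1X (p : {poly R}) (u : R) i :
  ((1 + u *: 'X) * p)`_i.+1 = p`_i.+1 + u * p`_i.
Proof. by rewrite mulrDl mul1r -scalerAl coefD coefZ coefXM. Qed.

Lemma coef_mul1X0 (p : {poly R}) (u : R) : ((1 + u *: 'X) * p)`_0 = p`_0.
Proof. by rewrite mulrDl mul1r -scalerAl coefD coefZ coefXM mulr0 addr0. Qed.

Lemma log_concave_prod (P : pred 'I_m) w : (forall j, 0 <= w j) ->
  log_concave (fun i => (\prod_(j | P j) (1 + w j *: 'X))`_i).
Proof.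
move=> w0; elim/big_rec: _ => [|j p _ lp].
  split=> [i|i j ij]; rewrite !coef1; first by case: (i == _).
  by rewrite mulr0.
apply: log_concave_mul1X (w0 j) lp _ _; first exact: coef_mul1X0.
exact: coef_mul1X.
Qed.

(** Subsets containing [j] disappear when [w j] is replaced by [0]. *)
Lemma sum_avoid1 w k j :
  \sum_(S : {set 'I_m} | (#|S| == k) && (j \notin S)) \prod_(i in S) w i =
  (\prod_(i | i != j) (1 + w i *: 'X))`_k.
Proof.
pose w' i := if i == j then 0 else w i.
transitivity (\sum_(S : {set 'I_m} | #|S| == k) \prod_(i in S) w' i).
  rewrite [RHS](bigID (fun S => j \notin S))/= [X in _ + X]big1 ?addr0.
    apply: eq_bigr => S /andP[_ jS]; apply: eq_bigr => i iS.
    by rewrite /w' ifN//; apply: contraNneq jS => <-.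
  move=> S /andP[_ /negPn jS]; rewrite (bigD1 j)//= /w' eqxx mul0r//.
rewrite sum_prod_coef (bigD1 j)//= /w' eqxx scale0r addr0 mul1r.
by rewrite (eq_bigr (fun i => 1 + w i *: 'X))// => i /negbTE ->.
Qed.

Lemma sum_avoid2 w k j l : j != l ->
  \sum_(S : {set 'I_m} | (#|S| == k) && ((j \notin S) && (l \notin S))) \prod_(i in S) w i =
  (\prod_(i | (i != j) && (i != l)) (1 + w i *: 'X))`_k.
Proof.
move=> jl; pose w' i := if i == j then 0 else w i.
transitivity (\sum_(S : {set 'I_m} | (#|S| == k) && (l \notin S)) \prod_(i in S) w' i).
  rewrite [RHS](bigID (fun S => j \notin S))/= [X in _ + X]big1 ?addr0.
    apply: eq_big => [S|S /and3P[_ jS lS]]; first by rewrite -andbA (andbC (j \notin S)).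
    apply: eq_bigr => i iS.
    by rewrite /w' ifN//; apply: contraNneq jS => <-.
  move=> S /andP[_ /negPn jS]; rewrite (bigD1 j)//= /w' eqxx mul0r//.
rewrite sum_avoid1 (bigD1 j)//= /w' eqxx scale0r addr0 mul1r.
rewrite (eq_bigr (fun i => 1 + w i *: 'X)); last by move=> i /andP[_ /negbTE ->].
by rewrite (eq_bigl (fun i => (i != j) && (i != l)))// => i; exact: andbC.
Qed.

(** Negative correlation of a random k-subset with product weights: the events
   of avoiding two distinct points are negatively correlated.  With [a] the
   coefficients of the product over the other points, the difference of the two
   sides is [w j * w l * (a (k - 1) ^ 2 - a k * a (k - 2))]. *)
Lemma avoid_negatively_correlated w k j l : (forall i, 0 <= w i) -> j != l ->
  (\sum_(S : {set 'I_m} | (#|S| == k) && ((j \notin S) && (l \notin S))) \prod_(i in S) w i) *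
  (\sum_(S : {set 'I_m} | #|S| == k) \prod_(i in S) w i) <=
  (\sum_(S : {set 'I_m} | (#|S| == k) && (j \notin S)) \prod_(i in S) w i) *
  (\sum_(S : {set 'I_m} | (#|S| == k) && (l \notin S)) \prod_(i in S) w i).
Proof.
move=> w0 jl.
rewrite sum_avoid2// !sum_avoid1 sum_prod_coef.
have [a0 ac] := log_concave_prod (fun i => (i != j) && (i != l)) w0.
set p := \prod_(i | (i != j) && (i != l)) _ in a0 ac *.
set u := w j; set v := w l.
have e2 : \prod_(i | i != j) (1 + w i *: 'X) = (1 + v *: 'X) * p.
  by rewrite (bigD1 l)// eq_sym.
have e3 : \prod_(i | i != l) (1 + w i *: 'X) = (1 + u *: 'X) * p.
  rewrite (bigD1 j)//; congr (_ * _); apply: eq_bigl => i; exact: andbC.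
have -> : \prod_i (1 + w i *: 'X) = (1 + u *: 'X) * ((1 + v *: 'X) * p).
  by rewrite (bigD1 j)//= e2.
rewrite e2 e3.
have u0 : 0 <= u := w0 j; have v0 : 0 <= v := w0 l.
case: k => [|[|k]].
- by rewrite !coef_mul1X0.
- rewrite !coef_mul1X !coef_mul1X0.
  have := mulr_ge0 (mulr_ge0 u0 v0) (mulr_ge0 (a0 0%N) (a0 0%N)); nra.
- rewrite !coef_mul1X.
  have : 0 <= u * v * (p`_k.+1 * p`_k.+1 - p`_k * p`_k.+2).
    by rewrite mulr_ge0 ?mulr_ge0// subr_ge0 ac.
  nra.
Qed.

End elementary_symmetric.

(** * The Hessian of a min-max free energy *)

Lemma sum_sqr_ge (R : realFieldType) (J : finType) (f : J -> R) :
  (\sum_j f j) ^+ 2 <= #|J|%:R * \sum_j f j ^+ 2.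
Proof.
have : 0 <= \sum_i \sum_j (f i - f j) ^+ 2.
  by apply: sumr_ge0 => i _; apply: sumr_ge0 => j _; exact: sqr_ge0.
have -> : \sum_i \sum_j (f i - f j) ^+ 2 =
   #|J|%:R * (\sum_j f j ^+ 2) + #|J|%:R * (\sum_j f j ^+ 2) - 2 * (\sum_j f j) ^+ 2.
  have -> : \sum_i \sum_j (f i - f j) ^+ 2 =
      \sum_i \sum_j (f i ^+ 2 + f j ^+ 2 - 2 * (f i * f j)).
    by apply: eq_bigr => i _; apply: eq_bigr => j _; ring.
  under eq_bigr do rewrite sumrB big_split/= sumr_const -mulr_sumr -mulr_sumr.
  rewrite sumrB big_split/= sumr_const -mulr_sumr -mulr_suml expr2.
  by rewrite sumrMnl !mulr_natl.
lra.
Qed.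

Section quadratic_form.
Variables (R : realFieldType) (I : finType) (M : I -> I -> R).
Hypotheses (M_row : forall a, \sum_b M a b = 0) (M_col : forall b, \sum_a M a b = 0).

(** A quadratic form whose rows and columns sum to zero only sees the
   differences of the coordinates; this is how covariances disappear in favour of
   the increments. *)
Lemma quadratic_increments (z : I -> R) :
  \sum_a \sum_b M a b * (z a * z b) =
  - (2^-1 * \sum_a \sum_b M a b * (z a - z b) ^+ 2).
Proof.
have h1 : \sum_a \sum_b M a b * z a ^+ 2 = 0.
  by rewrite big1// => a _; rewrite -mulr_suml M_row mul0r.
have h2 : \sum_a \sum_b M a b * z b ^+ 2 = 0.
  by rewrite exchange_big/= big1// => b _; rewrite -mulr_suml M_col mul0r.
have -> : \sum_a \sum_b M a b * (z a - z b) ^+ 2 =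
    (\sum_a \sum_b M a b * z a ^+ 2 + \sum_a \sum_b M a b * z b ^+ 2) -
    2 * \sum_a \sum_b M a b * (z a * z b).
  rewrite mulr_sumr -big_split -sumrB/=; apply: eq_bigr => a _.
  rewrite mulr_sumr -big_split -sumrB/=; apply: eq_bigr => b _; ring.
by rewrite h1 h2 addr0 sub0r mulrN opprK mulKf.
Qed.

End quadratic_form.

Section gibbs_matrix.
Variables (R : realFieldType) (n m k : nat).
Variables (p : 'I_n -> R) (q : 'I_n -> 'I_m -> R) (q2 : 'I_n -> 'I_m -> 'I_m -> R).
Variables (b1 b2 : R).
Hypotheses (b1_ge0 : 0 <= b1) (b2_ge0 : 0 <= b2).
Hypotheses (p_ge0 : forall i, 0 <= p i) (sum_p : \sum_i p i = 1).
Hypotheses (q_ge0 : forall i j, 0 <= q i j) (sum_q : forall i, \sum_j q i j = k%:R).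
Hypotheses (q2C : forall i j l, q2 i j l = q2 i l j)
  (q2_diag : forall i j, q2 i j j = q i j)
  (sum_q2 : forall i j, \sum_l q2 i j l = k%:R * q i j)
  (q2_neg : forall i j l, j != l -> q2 i j l <= q i j * q i l).

(** Here [p] weighs the rows, and [q], [q2] are the probabilities that the random
   subset of a row contains one point, or two. *)
Definition gibbs_hessian (a b : 'I_n * 'I_m) : R :=
  (a.1 == b.1)%:R * (b2 * p a.1 * (q2 a.1 a.2 b.2 - q a.1 a.2 * q a.1 b.2)
                     - b1 * p a.1 * (q a.1 a.2 * q a.1 b.2))
  + b1 * (p a.1 * q a.1 a.2) * (p b.1 * q b.1 b.2).
Local Notation M := gibbs_hessian.

Let sum_pair (f : 'I_n -> 'I_m -> R) : \sum_(a : 'I_n * 'I_m) f a.1 a.2 = \sum_i \sum_j f i j.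
Proof. by rewrite pair_bigA. Qed.

Let sum_row (f : 'I_n -> 'I_m -> R) (i : 'I_n) :
  \sum_(b : 'I_n * 'I_m) (i == b.1)%:R * f b.1 b.2 = \sum_j f i j.
Proof.
rewrite (sum_pair (fun i' j => (i == i')%:R * f i' j)) (bigD1 i)//= eqxx.
rewrite [X in _ + X]big1 ?addr0; first by apply: eq_bigr => j _; rewrite mul1r.
by move=> i' i'i; rewrite big1// => j _; rewrite eq_sym (negbTE i'i) mul0r.
Qed.

Let sum_pq : \sum_(b : 'I_n * 'I_m) p b.1 * q b.1 b.2 = k%:R.
Proof.
rewrite (sum_pair (fun i j => p i * q i j)).
under eq_bigr do rewrite -mulr_sumr sum_q.
by rewrite -mulr_suml sum_p mul1r.
Qed.

Lemma gibbs_hessianC a b : M a b = M b a.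
Proof.
rewrite /M eq_sym; case: eqP => [<-|_]; last by rewrite !mul0r; ring.
by rewrite q2C; ring.
Qed.

Lemma gibbs_hessian_row a : \sum_b M a b = 0.
Proof.
rewrite /M big_split/= -mulr_sumr sum_pq.
rewrite (eq_bigr (fun b : 'I_n * 'I_m => (a.1 == b.1)%:R *
  (fun i j => b2 * p i * (q2 i a.2 j - q i a.2 * q i j)
              - b1 * p i * (q i a.2 * q i j)) b.1 b.2)); last first.
  by move=> b _ /=; case: eqP => [->|_]; rewrite ?mul0r.
rewrite (sum_row (fun i j => b2 * p i * (q2 i a.2 j - q i a.2 * q i j)
              - b1 * p i * (q i a.2 * q i j))).
rewrite sumrB -!mulr_sumr sumrB sum_q2 -!mulr_sumr !sum_q; ring.
Qed.

Lemma gibbs_hessian_col b : \sum_a M a b = 0.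
Proof. by under eq_bigr do rewrite gibbs_hessianC; exact: gibbs_hessian_row. Qed.

(** A variance within the rows minus a variance between the rows. *)
Lemma gibbs_hessian_quad (z : 'I_n * 'I_m -> R) :
  \sum_a \sum_b M a b * (z a * z b) =
  \sum_i p i * (b2 * (\sum_j \sum_l q2 i j l * (z (i, j) * z (i, l))
                      - (\sum_j q i j * z (i, j)) ^+ 2))
  - b1 * (\sum_i p i * (\sum_j q i j * z (i, j)) ^+ 2
          - (\sum_i p i * \sum_j q i j * z (i, j)) ^+ 2).
Proof.
pose D i j l := b2 * p i * (q2 i j l - q i j * q i l) - b1 * p i * (q i j * q i l).
have row (a : 'I_n * 'I_m) : \sum_b M a b * (z a * z b) =
    \sum_l D a.1 a.2 l * (z a * z (a.1, l)) +
    b1 * (p a.1 * q a.1 a.2 * z a) * \sum_i p i * \sum_j q i j * z (i, j).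
  have -> : \sum_b M a b * (z a * z b) =
    \sum_(b : 'I_n * 'I_m) ((a.1 == b.1)%:R *
       (fun i l => D i a.2 l * (z a * z (i, l))) b.1 b.2 +
       b1 * (p a.1 * q a.1 a.2 * z a) * (fun i j => p i * (q i j * z (i, j))) b.1 b.2).
    apply: eq_bigr => b _; rewrite /M /D -surjective_pairing.
    by case: eqP => [->|_]; rewrite ?mul0r; ring.
  rewrite big_split/= (sum_row (fun i l => D i a.2 l * (z a * z (i, l)))).
  rewrite -mulr_sumr (sum_pair (fun i j => p i * (q i j * z (i, j)))).
  by congr (_ + _ * _); apply: eq_bigr => i _; rewrite mulr_sumr.
under eq_bigr do rewrite row.
rewrite big_split/= -mulr_suml -mulr_sumr.
have -> : \sum_(a : 'I_n * 'I_m) p a.1 * q a.1 a.2 * z a =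
    \sum_i p i * \sum_j q i j * z (i, j).
  rewrite (eq_bigr (fun a : 'I_n * 'I_m => (fun i j => p i * (q i j * z (i, j))) a.1 a.2)).
    rewrite (sum_pair (fun i j => p i * (q i j * z (i, j)))).
    by apply: eq_bigr => i _; rewrite mulr_sumr.
  by move=> a _ /=; rewrite -surjective_pairing mulrA.
have -> : \sum_(a : 'I_n * 'I_m) \sum_l D a.1 a.2 l * (z a * z (a.1, l)) =
    \sum_i \sum_j \sum_l D i j l * (z (i, j) * z (i, l)).
  rewrite -(sum_pair (fun i j => \sum_l D i j l * (z (i, j) * z (i, l)))).
  by apply: eq_bigr => a _; rewrite -surjective_pairing.
have -> : \sum_i \sum_j \sum_l D i j l * (z (i, j) * z (i, l)) =
    \sum_i p i * (b2 * (\sum_j \sum_l q2 i j l * (z (i, j) * z (i, l))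
                      - (\sum_j q i j * z (i, j)) ^+ 2)) -
    b1 * \sum_i p i * (\sum_j q i j * z (i, j)) ^+ 2.
  rewrite mulr_sumr -sumrB; apply: eq_bigr => i _.
  have sqE : (\sum_j q i j * z (i, j)) ^+ 2 =
      \sum_j \sum_l q i j * q i l * (z (i, j) * z (i, l)).
    rewrite expr2 mulr_suml; apply: eq_bigr => j _; rewrite mulr_sumr.
    by apply: eq_bigr => l _; ring.
  have -> : \sum_j \sum_l D i j l * (z (i, j) * z (i, l)) =
    b2 * p i * (\sum_j \sum_l q2 i j l * (z (i, j) * z (i, l))) -
    (b2 * p i + b1 * p i) * \sum_j \sum_l q i j * q i l * (z (i, j) * z (i, l)).
    rewrite !mulr_sumr -sumrB; apply: eq_bigr => j _.
    rewrite !mulr_sumr -sumrB; apply: eq_bigr => l _; rewrite /D; ring.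
  rewrite -sqE; ring.
ring.
Qed.

(** Both contributions are nonpositive: the first by negative correlation, the
   second because [p i ^ 2 <= p i]. *)
Lemma gibbs_hessian_same i j l : j != l -> M (i, j) (i, l) <= 0.
Proof.
move=> jl; rewrite /M/= eqxx mul1r.
have p1 : p i <= 1.
  by rewrite -sum_p (bigD1 i)//= lerDl sumr_ge0.
have h1 : 0 <= b2 * p i * (q i j * q i l - q2 i j l).
  by rewrite !mulr_ge0// subr_ge0 q2_neg.
have h2 : 0 <= b1 * p i * (q i j * q i l) * (1 - p i).
  by rewrite !mulr_ge0// subr_ge0.
nra.
Qed.

Lemma gibbs_hessian_diff a b : a.1 != b.1 -> 0 <= M a b.
Proof. by move=> ab; rewrite /M (negbTE ab) mul0r add0r !mulr_ge0. Qed.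

(** Signs of the entries turn the sum of absolute values into a trace, because
   all entries sum to zero. *)
Lemma gibbs_hessian_offdiag (De : 'I_n * 'I_m -> 'I_n * 'I_m -> R) (g : R) :
  (0 < n)%N -> (0 < m)%N ->
  (forall a, De a a = 0) -> (forall a b, `|De a b| <= g) ->
  \sum_a \sum_b M a b * De a b <=
  g * (b1 * (k%:R * (k%:R * (1 - 1 / n%:R) * (2 - 1 / m%:R)))
       + b2 * (k%:R * (1 - k%:R / m%:R))).
Proof.
move=> n0 m0 De0 Deg.
have n0' : 0 < n%:R :> R by rewrite ltr0n.
have m0' : 0 < m%:R :> R by rewrite ltr0n.
have g0 : 0 <= g by exact: le_trans (normr_ge0 _) (Deg (Ordinal n0, Ordinal m0) (Ordinal n0, Ordinal m0)).
(* the entry [M a b] with the sign that makes it nonnegative, and [0] on the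
   diagonal *)
pose N a b := - M a b + 2 * ((a.1 != b.1)%:R * M a b) + (a == b)%:R * M a b.
apply: (@le_trans _ _ (g * \sum_a \sum_b N a b)).
  rewrite mulr_sumr; apply: ler_sum => -[i j] _.
  rewrite mulr_sumr; apply: ler_sum => -[i' l] _.
  have /andP[hl hu] : - g <= De (i, j) (i', l) <= g by rewrite -ler_norml.
  rewrite /N; have [ab|ab] := eqVneq (i, j) (i', l).
    by case: ab => -> ->; rewrite De0 /= eqxx mul0r mulr0 mul1r addr0 addNr !mulr0.
  rewrite mul0r addr0/=; have [ii|ii] := eqVneq i i'.
    rewrite ii in ab hl hu *; rewrite /= mul0r mulr0 addr0.
    have : M (i', j) (i', l) <= 0.
      by apply: gibbs_hessian_same; apply: contraNneq ab => ->.
    nra.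
  have : 0 <= M (i, j) (i', l) by exact: gibbs_hessian_diff.
  rewrite /= mul1r; nra.
rewrite ler_wpM2l//.
have sumN : \sum_a \sum_b N a b =
  2 * (\sum_a \sum_(b : 'I_n * 'I_m) (a.1 != b.1)%:R * M a b) + \sum_a M a a.
  under eq_bigr => a _ do rewrite 2!big_split/= sumrN gibbs_hessian_row oppr0 add0r.
  rewrite big_split/=; congr (_ + _).
    by rewrite mulr_sumr; apply: eq_bigr => a _; rewrite mulr_sumr.
  apply: eq_bigr => a _; rewrite (bigD1 a)//= eqxx mul1r big1 ?addr0//.
  by move=> b /negbTE ba; rewrite eq_sym ba mul0r.
pose sp := \sum_i p i ^+ 2.
pose sq i := \sum_j q i j ^+ 2.
have off : \sum_a \sum_(b : 'I_n * 'I_m) (a.1 != b.1)%:R * M a b = b1 * k%:R ^+ 2 * (1 - sp).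
  have E (a : 'I_n * 'I_m) : \sum_(b : 'I_n * 'I_m) (a.1 != b.1)%:R * M a b =
      b1 * k%:R * (p a.1 * q a.1 a.2) - b1 * k%:R * (p a.1 ^+ 2 * q a.1 a.2).
    have -> : \sum_(b : 'I_n * 'I_m) (a.1 != b.1)%:R * M a b =
      \sum_(b : 'I_n * 'I_m) (b1 * (p a.1 * q a.1 a.2) * (p b.1 * q b.1 b.2) -
        (a.1 == b.1)%:R * (fun i j => b1 * (p a.1 * q a.1 a.2) * (p i * q i j)) b.1 b.2).
      by apply: eq_bigr => b _; rewrite /M; case: eqP => [_|_] /=; ring.
    rewrite sumrB -mulr_sumr sum_pq.
    rewrite (sum_row (fun i j => b1 * (p a.1 * q a.1 a.2) * (p i * q i j))).
    by rewrite -!mulr_sumr sum_q; ring.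
  under eq_bigr do rewrite E.
  rewrite sumrB -!mulr_sumr sum_pq (sum_pair (fun i j => p i ^+ 2 * q i j)).
  under eq_bigr do rewrite -mulr_sumr sum_q.
  by rewrite -mulr_suml -/sp; ring.
have diag : \sum_a M a a =
   \sum_i (b2 * p i * (k%:R - sq i) - b1 * (p i - p i ^+ 2) * sq i).
  have -> : \sum_a M a a = \sum_(a : 'I_n * 'I_m)
    (fun i j => b2 * p i * (q i j - q i j ^+ 2) - b1 * (p i - p i ^+ 2) * q i j ^+ 2) a.1 a.2.
    by apply: eq_bigr => a _; rewrite /M eqxx mul1r q2_diag/=; ring.
  rewrite (sum_pair (fun i j => b2 * p i * (q i j - q i j ^+ 2) - b1 * (p i - p i ^+ 2) * q i j ^+ 2)).
  by apply: eq_bigr => i _; rewrite sumrB -!mulr_sumr sumrB sum_q.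
have sp_ge : 1 / n%:R <= sp.
  have := sum_sqr_ge p; rewrite sum_p expr1n card_ord -/sp.
  by rewrite ler_pdivrMr// mulrC.
have sq_ge i : k%:R ^+ 2 / m%:R <= sq i.
  have := sum_sqr_ge (q i); rewrite sum_q card_ord -/(sq i).
  by rewrite ler_pdivrMr// mulrC.
have diag_le : \sum_a M a a <=
    b2 * (k%:R - k%:R ^+ 2 / m%:R) - b1 * (1 - sp) * (k%:R ^+ 2 / m%:R).
  have -> : b2 * (k%:R - k%:R ^+ 2 / m%:R) - b1 * (1 - sp) * (k%:R ^+ 2 / m%:R) =
    \sum_i (b2 * p i * (k%:R - k%:R ^+ 2 / m%:R) - b1 * (p i - p i ^+ 2) * (k%:R ^+ 2 / m%:R)).
    by rewrite sumrB -!mulr_suml -!mulr_sumr sum_p sumrB sum_p -/sp; ring.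
  rewrite diag; apply: ler_sum => i _.
  have p1 : p i <= 1 by rewrite -sum_p (bigD1 i)//= lerDl sumr_ge0.
  apply: lerB.
    by rewrite ler_wpM2l ?mulr_ge0// lerB.
  by rewrite ler_wpM2l// mulr_ge0// subr_ge0 expr2 ler_piMr.
rewrite sumN off.
have m1 : 1 / m%:R <= 1 :> R by rewrite ler_pdivrMr// mul1r ler1n.
have k2 : 0 <= k%:R ^+ 2 :> R by exact: sqr_ge0.
have h : 0 <= b1 * k%:R ^+ 2 * (2 - 1 / m%:R) * (sp - 1 / n%:R).
  by rewrite !mulr_ge0// subr_ge0//; apply: le_trans m1 _; rewrite ler1n.
move: diag_le h; rewrite !mul1r; set im := m%:R^-1; set iN := n%:R^-1; nra.
Qed.

End gibbs_matrix.

(** * Calculus of log-sum-exp *)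

Section derivatives.
Context (R : realType).

Lemma is_derive_bigsum (J : Type) (r : seq J) (Q : pred J) (f : J -> R -> R)
    (df : J -> R) (s : R) :
  (forall j, Q j -> is_derive s 1 (f j) (df j)) ->
  is_derive s 1 (fun t => \sum_(j <- r | Q j) f j t) (\sum_(j <- r | Q j) df j).
Proof.
move=> h; elim: r => [|j r IH].
  by under eq_fun do rewrite big_nil; rewrite big_nil; exact: is_derive_cst.
under eq_fun do rewrite big_cons; rewrite big_cons; case: ifP => // Qj.
by have := h j Qj => hj; exact: is_deriveD.
Qed.

Lemma mean_value_bound (f df : R -> R) (L : R) :
  (forall s : R, is_derive s 1 f (df s)) ->
  (forall s, 0 <= s <= 1 -> `|df s| <= L) -> f 0 = 0 ->
  forall s, 0 <= s <= 1 -> `|f s| <= L.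
Proof.
move=> fd fL f0 s /andP[s0 s1].
have cf : continuous f.
  by move=> x; apply/differentiable_continuous/derivable1_diffP/ex_derive.
have [c] := @MVT_segment R f df 0 s s0 (fun x _ => fd x) (continuous_subspaceT cf).
rewrite in_itv/= f0 !subr0 => /andP[c0 cs] ->.
have cL : `|df c| <= L by apply: fL; rewrite c0 (le_trans cs).
by rewrite normrM (ger0_norm s0) (le_trans _ cL)// ler_piMr.
Qed.

(** Closed under the operations that build the second derivative of the smoothed
   functional, this keeps track of the constant in its Lipschitz bound. *)
Definition bounded_deriv (a b : R) (f : R -> R) : Prop :=
  (forall s, `|f s| <= a) /\
  exists df, forall s : R, is_derive s 1 f (df s) /\ `|df s| <= b.

Lemma bounded_derivD a b f a' b' g : bounded_deriv a b f ->
  bounded_deriv a' b' g -> bounded_deriv (a + a') (b + b') (fun s => f s + g s).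
Proof.
move=> [fa [df hf]] [ga [dg hg]]; split=> [s|].
  by rewrite (le_trans (ler_normD _ _))// lerD.
exists (fun s => df s + dg s) => s; have [h1 h2] := hf s; have [k1 k2] := hg s.
by split; [exact: is_deriveD|rewrite (le_trans (ler_normD _ _))// lerD].
Qed.

Lemma bounded_derivZ a b f c : bounded_deriv a b f ->
  bounded_deriv (`|c| * a) (`|c| * b) (fun s => c * f s).
Proof.
move=> [fa [df hf]]; split=> [s|]; first by rewrite normrM ler_wpM2l.
exists (fun s => c * df s) => s; have [h1 h2] := hf s.
by split; [exact: is_deriveZ|rewrite normrM ler_wpM2l].
Qed.

Lemma bounded_deriv_sqr a b f : bounded_deriv a b f ->
  bounded_deriv (a ^+ 2) (2 * a * b) (fun s => f s ^+ 2).
Proof.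
move=> [fa [df hf]].
have a0 : 0 <= a by exact: le_trans (normr_ge0 (f 0)) (fa 0).
split=> [s|]; first by rewrite normrX lerXn2r// nnegrE.
exists (fun s => 2 * f s * df s) => s; have [h1 h2] := hf s.
split; last by rewrite !normrM (ger0_norm (ler0n _ 2)) -!mulrA ler_wpM2l// ler_pM.
apply: is_derive_eq; rewrite /GRing.scale/=; ring.
Qed.

Lemma taylor_bound (f f1 f2 : R -> R) (a L : R) :
  (forall s : R, is_derive s 1 f (f1 s)) ->
  (forall s : R, is_derive s 1 f1 (f2 s)) -> bounded_deriv a L f2 ->
  `|f 1 - f 0 - f1 0 - 2^-1 * f2 0| <= L.
Proof.
move=> d1 d2 [_ [f3 h3]].
have d3 (s : R) : is_derive s 1 f2 (f3 s) by have [] := h3 s.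
have one : 0 <= (1 : R) <= 1 by rewrite ler01 lexx.
have b2 : forall s, 0 <= s <= 1 -> `|f2 s - f2 0| <= L.
  apply: (@mean_value_bound (fun s => f2 s - f2 0) f3) => [s|s _|].
  - by have := d3 s => ds; apply: is_derive_eq; rewrite subr0.
  - by have [] := h3 s.
  - by rewrite subrr.
have b1 : forall s, 0 <= s <= 1 -> `|f1 s - f1 0 - s * f2 0| <= L.
  apply: (@mean_value_bound (fun s => f1 s - f1 0 - s * f2 0) (fun s => f2 s - f2 0)) => //.
  - by move=> s; have := d2 s => ds; apply: is_derive_eq; rewrite /GRing.scale/=; ring.
  - by rewrite mul0r !subrr.
have b0 : forall s, 0 <= s <= 1 -> `|f s - f 0 - s * f1 0 - 2^-1 * s ^+ 2 * f2 0| <= L.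
  apply: (@mean_value_bound (fun s => f s - f 0 - s * f1 0 - 2^-1 * s ^+ 2 * f2 0)
    (fun s => f1 s - f1 0 - s * f2 0)) => //.
  - move=> s; have := d1 s => ds; apply: is_derive_eq; rewrite /GRing.scale/=; by field.
  - by rewrite expr0n/= !mulr0 !mul0r !subrr.
by have := b0 1 one; rewrite mul1r expr1n mulr1.
Qed.

End derivatives.

Section softmax.
Context (R : realType) (J : finType) (Q : pred J).
Hypothesis Q_neq0 : exists j, Q j.
Implicit Types u : J -> R.

Definition lse u := ln (\sum_(j | Q j) expR (u j)).
Definition gibbs u j := expR (u j) / \sum_(l | Q l) expR (u l).

Lemma expsum_gt0 u : 0 < \sum_(j | Q j) expR (u j).
Proof.
have [j Qj] := Q_neq0; rewrite (bigD1 j)//= ltr_wpDr ?expR_gt0//.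
by apply: sumr_ge0 => i _; exact: expR_ge0.
Qed.

Lemma gibbs_ge0 u j : 0 <= gibbs u j.
Proof. by rewrite divr_ge0 ?expR_ge0// ltW// expsum_gt0. Qed.

Lemma sum_gibbs u : \sum_(j | Q j) gibbs u j = 1.
Proof. by rewrite -mulr_suml divff// gt_eqF// expsum_gt0. Qed.

Lemma gibbs_avg_le u (f : J -> R) a : (forall j, Q j -> `|f j| <= a) ->
  `|\sum_(j | Q j) gibbs u j * f j| <= a.
Proof.
move=> fa; apply: (le_trans (ler_norm_sum _ _ _)).
apply: (@le_trans _ _ (\sum_(j | Q j) gibbs u j * a)).
  by apply: ler_sum => j Qj; rewrite normrM ger0_norm ?gibbs_ge0// ler_wpM2l ?gibbs_ge0// fa.
by rewrite -mulr_suml sum_gibbs mul1r.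
Qed.

Lemma lse_ge u j : Q j -> u j <= lse u.
Proof.
move=> Qj; rewrite -[leLHS]expRK ler_ln ?posrE ?expR_gt0 ?expsum_gt0//.
by rewrite (bigD1 j)//= lerDl sumr_ge0// => i _; exact: expR_ge0.
Qed.

Lemma lse_le u c : (forall j, Q j -> u j <= c) -> lse u <= c + ln #|Q|%:R.
Proof.
move=> uc; have Q0 : (0 < #|Q|)%N.
  by have [j Qj] := Q_neq0; apply/card_gt0P; exists j.
rewrite -[c in leRHS]expRK -lnM ?posrE ?expR_gt0 ?ltr0n//.
rewrite ler_ln ?posrE ?expsum_gt0 ?mulr_gt0 ?expR_gt0 ?ltr0n//.
apply: (@le_trans _ _ (\sum_(j | Q j) expR c)).
  by apply: ler_sum => j Qj; rewrite ler_expR uc.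
by rewrite sumr_const mulr_natr.
Qed.

Variables (u du : J -> R -> R).
Hypothesis u_deriv : forall j (s : R), is_derive s 1 (u j) (du j s).
Local Notation us s := (u^~ s).

Let is_derive_expsum (s : R) : is_derive s 1
  (fun s => \sum_(j | Q j) expR (u j s)) (\sum_(j | Q j) expR (u j s) * du j s).
Proof.
exact: is_derive_bigsum.
Qed.

Lemma is_derive_lse (s : R) : is_derive s 1 (fun s => lse (us s))
  (\sum_(j | Q j) gibbs (us s) j * du j s).
Proof.
have h := is_derive_expsum s.
have hl := is_derive1_ln (expsum_gt0 (us s)).
rewrite /lse; apply: is_derive_eq; rewrite /GRing.scale/= ?mulr_suml ?mulr_sumr.
by apply: eq_bigr => j _; rewrite /gibbs; ring.
Qed.

Lemma is_derive_gibbs j (s : R) : is_derive s 1 (fun s => gibbs (us s) j)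
  (gibbs (us s) j * (du j s - \sum_(l | Q l) gibbs (us s) l * du l s)).
Proof.
have E t : gibbs (us t) j = expR (u j t - lse (us t)).
  by rewrite /gibbs expRD expRN lnK// posrE expsum_gt0.
have := is_derive_lse s => hl; have := u_deriv j s => hj.
rewrite (_ : (fun s => _) = fun t => expR (u j t - lse (us t))); last by apply/funext.
by apply: is_derive_eq; rewrite E mulrC.
Qed.

(** The average derivative plus the covariance with the derivative of the energy. *)
Lemma is_derive_gibbs_avg (v dv : J -> R -> R) (s : R) :
  (forall j, is_derive s 1 (v j) (dv j s)) ->
  is_derive s 1 (fun s => \sum_(j | Q j) gibbs (us s) j * v j s)
   (\sum_(j | Q j) gibbs (us s) j * dv j s +
    (\sum_(j | Q j) gibbs (us s) j * (du j s * v j s) -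
     (\sum_(j | Q j) gibbs (us s) j * du j s) * (\sum_(j | Q j) gibbs (us s) j * v j s))).
Proof.
move=> hv.
have h : is_derive s 1 (fun s => \sum_(j | Q j) gibbs (us s) j * v j s)
  (\sum_(j | Q j) (gibbs (us s) j * dv j s + v j s * (gibbs (us s) j *
     (du j s - \sum_(l | Q l) gibbs (us s) l * du l s)))).
  apply: is_derive_bigsum => j Qj; have := is_derive_gibbs j s => hg.
  by have := hv j => hj; apply: is_derive_eq.
apply: (is_derive_eq h); rewrite big_split/=; congr (_ + _).
rewrite [X in _ = _ - X]mulrC mulr_suml -sumrB.
by apply: eq_bigr => j _; ring.
Qed.

Lemma bounded_deriv_gibbs_avg (v : J -> R -> R) (a b c : R) :
  (forall j, Q j -> forall s, `|du j s| <= c) ->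
  (forall j, bounded_deriv a b (v j)) ->
  bounded_deriv a (2 * c * a + b) (fun s => \sum_(j | Q j) gibbs (us s) j * v j s).
Proof.
move=> duc hv.
have /choice[dv hdv] : forall j, exists dv : R -> R,
    forall s : R, is_derive s 1 (v j) (dv s) /\ `|dv s| <= b.
  by move=> j; have [_] := hv j.
have va j s : `|v j s| <= a by have [] := hv j.
split=> [s|]; first by apply: gibbs_avg_le => j _.
eexists => s; split; first by apply: (@is_derive_gibbs_avg _ dv) => j; have [] := hdv j s.
have [j0 Qj0] := Q_neq0.
have a0 : 0 <= a := le_trans (normr_ge0 _) (va j0 0).
have c0 : 0 <= c := le_trans (normr_ge0 _) (duc j0 Qj0 0).
have -> : 2 * c * a + b = b + (c * a + c * a) by ring.
apply: (le_trans (ler_normD _ _)); apply: lerD.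
  by apply: gibbs_avg_le => j _; have [] := hdv j s.
apply: (le_trans (ler_normB _ _)); apply: lerD.
  by apply: gibbs_avg_le => j Qj; rewrite normrM ler_pM// duc.
rewrite normrM ler_pM//; apply: gibbs_avg_le => // j Qj; exact: duc.
Qed.

End softmax.

(** * Sums of the largest entries and minima *)

Section top_sum.
Context (R : realType) (m k : nat).
Hypothesis k_bounds : (1 <= k <= m)%N.
Implicit Types (z : 'I_m -> R) (S : {set 'I_m}).

Definition top_sum z := \sum_(m - k + 1 <= h < m.+1) order_stat z h.

(** Sort the indices by value and cut; [c] is the smallest entry that is kept. *)
Lemma top_set z : exists (D : {set 'I_m}) (c : R),
  [/\ #|D| = k, top_sum z = \sum_(j in D) z j,
      forall j, j \in D -> c <= z j & forall j, j \notin D -> z j <= c].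
Proof.
have /andP[k1 km] := k_bounds.
pose t := sort (relpre z <=%R) (enum 'I_m).
have t_sorted : sorted (relpre z <=%R) t.
  by apply: sort_sorted => i j; exact: le_total.
have t_perm : perm_eq t (enum 'I_m) by rewrite /t perm_sort.
have t_uniq : uniq t by rewrite (perm_uniq t_perm) enum_uniq.
have t_size : size t = m by rewrite (perm_size t_perm) size_enum_ord.
have t_mem j : j \in t by rewrite (perm_mem t_perm) mem_enum.
have m0 : (0 < m)%N by exact: leq_trans k1 km.
pose j0 : 'I_m := Ordinal m0.
pose D := [set j in drop (m - k) t].
have D_uniq : uniq (drop (m - k) t) by rewrite drop_uniq.
exists D, (z (nth j0 t (m - k))).
have mono i j : (i <= j < m)%N -> z (nth j0 t i) <= z (nth j0 t j).
  move=> /andP[ij jm].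
  have tr : transitive (relpre z <=%R) by move=> a b c; exact: le_trans.
  have rf : reflexive (relpre z <=%R) by move=> a; exact: lexx.
  by apply: (sorted_leq_nth tr rf j0 t_sorted); rewrite ?inE ?t_size// (leq_ltn_trans ij).
have mem_t j : exists2 i, (i < m)%N & j = nth j0 t i.
  by exists (index j t); [rewrite -[X in (_ < X)%N]t_size index_mem|rewrite nth_index].
have memD i : (i < m)%N -> (nth j0 t i \in D) = (m - k <= i)%N.
  move=> im; rewrite inE; apply/idP/idP => [|mki].
    move=> /(nthP j0)[l]; rewrite size_drop t_size nth_drop => lk /eqP.
    rewrite nth_uniq ?t_size//; last by rewrite -ltn_subRL.
    by move=> /eqP <-; rewrite leq_addr.
  apply/(nthP j0); exists (i - (m - k))%N; last by rewrite nth_drop subnKC.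
  by rewrite size_drop t_size ltn_sub2r// (leq_ltn_trans mki).
split.
- rewrite cardsE (card_uniqP D_uniq) size_drop t_size subKn//.
- rewrite /top_sum (eq_bigl (fun j => j \in drop (m - k) t)); last by move=> j; rewrite inE.
  rewrite -big_uniq//= (big_nth j0) size_drop t_size subKn//.
  rewrite (_ : m.+1 = (k + (m - k + 1))%N); last by rewrite addn1 addnS subnKC.
  rewrite -[X in \sum_(X <= _ < _) _]add0n big_addn addnK.
  apply: eq_big_nat => i /andP[_ ik].
  rewrite /order_stat addn1 addnS/= nth_drop.
  have -> : [seq z j | j : 'I_m] = map z (enum 'I_m) by [].
  rewrite sort_map (nth_map j0) ?t_size ?size_sort ?size_enum_ord ?(addnC i)//.
  by rewrite -ltn_subRL subKn.
- move=> j; have [i im ->] := mem_t j; rewrite memD// => h.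
  by apply: mono; rewrite h.
- move=> j; have [i im ->] := mem_t j; rewrite memD// -ltnNge => h.
  by apply: mono; rewrite (ltnW h)/= ltn_subrL m0 k1.
Qed.

(** Measured from the threshold [c], entries of the top set are nonnegative and the
   others are nonpositive. *)
Lemma top_sum_max z S : #|S| = k -> \sum_(j in S) z j <= top_sum z.
Proof.
have [D [c [Dk -> cD Dc]]] := top_set z => Sk.
suff : \sum_(j in S) (z j - c) <= \sum_(j in D) (z j - c).
  by rewrite !sumrB !sumr_const Sk Dk lerD2r.
rewrite [leLHS](bigID (mem D))/= [leRHS](bigID (mem S))/=; apply: lerD.
  by rewrite le_eqVlt (eq_bigl (fun j => (j \in D) && (j \in S))) ?eqxx// => j; exact: andbC.
apply: (@le_trans _ _ 0).
  by apply: sumr_le0 => j /andP[_ /Dc]; rewrite subr_le0.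
by apply: sumr_ge0 => j /andP[/cD]; rewrite subr_ge0.
Qed.

Lemma top_sum_attained z : exists2 S : {set 'I_m}, #|S| = k & top_sum z = \sum_(j in S) z j.
Proof. by have [D [c [Dk E _ _]]] := top_set z; exists D. Qed.

End top_sum.

Section min_over.
Context (R : realType) (n : nat) (n_gt0 : (0 < n)%N).
Implicit Type f : 'I_n -> R.

Lemma min_over_le f i : min_over n_gt0 f <= f i.
Proof. by rewrite /min_over; exact: bigmin_le. Qed.

Lemma min_over_attained f : exists i, min_over n_gt0 f = f i.
Proof.
rewrite /min_over; elim/big_ind: _ => [|x y [i ->] [j ->]|i _].
- by exists (Ordinal n_gt0).
- by case: (leP (f i) (f j)) => _; [exists i|exists j].
- by exists i.
Qed.

End min_over.

(** * Smoothing of the minimum of the top sums *)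

Section smoothing.
Context (R : realType) (n m k : nat).
Hypotheses (n_gt0 : (0 < n)%N) (m_gt0 : (0 < m)%N) (k_bounds : (1 <= k <= m)%N).
Variables (b1 b2 : R).
Hypotheses (b1_gt0 : 0 < b1) (b2_gt0 : 0 < b2).
Local Notation idx := ('I_n * 'I_m)%type.
Implicit Types (v z : idx -> R) (i : 'I_n) (S : {set 'I_m}).

Definition ksubset : pred {set 'I_m} := fun S => #|S| == k.

Definition set_sum v i S := \sum_(j in S) v (i, j).

(** [b2] is the inverse temperature of the maximum over subsets. *)
Definition smooth_top v i := b2^-1 * lse ksubset (fun S => b2 * set_sum v i S).

(** [b1] is the inverse temperature of the minimum over rows. *)
Definition smooth_min_top v := - (b1^-1 * lse predT (fun i => - (b1 * smooth_top v i))).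

Definition exact_min_top v :=
  min_over n_gt0 (fun i => top_sum k (fun j => v (i, j))).

Lemma card_ksubset : #|ksubset| = 'C(m, k).
Proof.
have := card_draws 'I_m k; rewrite card_ord => <-.
by rewrite cardsE; apply: eq_card => S.
Qed.

Lemma ksubset_neq0 : exists S, ksubset S.
Proof.
have /andP[_ km] := k_bounds.
have : (0 < #|ksubset|)%N by rewrite card_ksubset bin_gt0.
by move=> /card_gt0P[S]; exists S.
Qed.

Lemma row_neq0 : exists i : 'I_n, (predT : pred 'I_n) i.
Proof. by exists (Ordinal n_gt0). Qed.

Lemma smooth_top_ge v i : top_sum k (fun j => v (i, j)) <= smooth_top v i.
Proof.
have [S Sk ->] := top_sum_attained k_bounds (fun j => v (i, j)).
rewrite /smooth_top ler_pdivlMl//.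
by apply: (lse_ge ksubset_neq0 (fun S => b2 * set_sum v i S)); rewrite /ksubset Sk.
Qed.

Lemma smooth_top_le v i :
  smooth_top v i <= top_sum k (fun j => v (i, j)) + ln ('C(m, k))%:R / b2.
Proof.
rewrite /smooth_top ler_pdivrMl// mulrDr (mulrC b2 (_ / _)) divfK ?gt_eqF//.
rewrite -card_ksubset; apply: (lse_le ksubset_neq0) => S /eqP Sk.
apply: ler_wpM2l; first exact: ltW.
exact: (top_sum_max k_bounds (fun j => v (i, j)) Sk).
Qed.

Lemma smooth_min_top_le v : smooth_min_top v <= exact_min_top v + ln ('C(m, k))%:R / b2.
Proof.
rewrite /exact_min_top; have [i ->] := min_over_attained n_gt0 (fun i => top_sum k (fun j => v (i, j))).
apply: (le_trans _ (smooth_top_le v i)).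
rewrite /smooth_min_top -mulrN ler_pdivrMl// lerNl.
exact: (lse_ge row_neq0 (fun i => - (b1 * smooth_top v i))).
Qed.

Lemma smooth_min_top_ge v : exact_min_top v - ln n%:R / b1 <= smooth_min_top v.
Proof.
rewrite /smooth_min_top lerNr opprB ler_pdivrMl// mulrBr.
rewrite (mulrC b1 (_ / _)) divfK ?gt_eqF// addrC -[X in ln X%:R](card_ord n).
apply: (lse_le row_neq0) => i _; rewrite lerN2; apply: ler_wpM2l; first exact: ltW.
apply: le_trans (smooth_top_ge v i).
exact: (min_over_le n_gt0 (fun i => top_sum k (fun j => v (i, j))) i).
Qed.

Lemma exact_min_top_growth v : `|exact_min_top v| <= \sum_a `|v a|.
Proof.
rewrite /exact_min_top; have [i ->] := min_over_attained n_gt0 (fun i => top_sum k (fun j => v (i, j))).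
have [S Sk ->] := top_sum_attained k_bounds (fun j => v (i, j)).
apply: (le_trans (ler_norm_sum _ _ _)).
have -> : \sum_a `|v a| = \sum_i0 \sum_j `|v (i0, j)|.
  by rewrite pair_bigA; apply: eq_bigr => -[].
rewrite (bigD1 i)//= ler_wpDr//.
  by apply: sumr_ge0 => l _; exact: sumr_ge0.
by rewrite [leRHS](bigID (mem S))/= lerDl sumr_ge0.
Qed.

Lemma lnN_ge0 (p : nat) : 0 <= ln p%:R :> R.
Proof.
case: p => [|p]; first by rewrite ln0.
by rewrite -ln1 ler_ln ?posrE// ler1n.
Qed.

Lemma smooth_min_top_growth v : `|smooth_min_top v| <=
  (ln n%:R / b1 + ln ('C(m, k))%:R / b2) + 1 * \sum_a `|v a|.
Proof.
have := smooth_min_top_ge v; have := smooth_min_top_le v.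
have := exact_min_top_growth v.
have h1 : 0 <= ln n%:R / b1 by rewrite divr_ge0 ?lnN_ge0// ltW.
have h2 : 0 <= ln ('C(m, k))%:R / b2 by rewrite divr_ge0 ?lnN_ge0// ltW.
by rewrite mul1r !ler_norml; lra.
Qed.

Lemma measurable_lse d (T : measurableType d) (J : finType) (Q : pred J)
    (u : J -> T -> R) : (forall j, measurable_fun [set: T] (u j)) ->
  measurable_fun [set: T] (fun w => lse Q (u^~ w)).
Proof.
move=> mu; rewrite /lse; apply: (measurableT_comp (f := @ln R)
  (g := fun w => \sum_(j | Q j) expR (u j w))); first exact: measurable_ln.
under eq_fun do rewrite big_mkcond.
apply: measurable_sum => j; case: (Q j) => //.
exact: measurableT_comp.
Qed.

Lemma measurable_smooth_min_top : measurable_fun [set: rvec R idx] smooth_min_top.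
Proof.
apply: measurable_funN; apply: measurable_funM => //.
apply: measurable_lse => i; apply: measurable_funN; apply: measurable_funM => //.
apply: measurable_funM => //; apply: measurable_lse => S.
apply: measurable_funM => //.
have -> : (fun v : rvec R idx => set_sum v i S) =
    (fun v => \sum_j (if j \in S then v (i, j) else 0)).
  by apply/funext => v; rewrite /set_sum big_mkcond.
apply: measurable_sum => j; case: (j \in S) => //; exact: measurable_coord.
Qed.

End smoothing.

(** * Gibbs weights and the second-order expansion *)

Section smoothing_weights.
Context (R : realType) (n m k : nat).
Hypotheses (n_gt0 : (0 < n)%N) (k_bounds : (1 <= k <= m)%N).
Variables (b1 b2 : R).
Hypotheses (b1_gt0 : 0 < b1) (b2_gt0 : 0 < b2).
Local Notation idx := ('I_n * 'I_m)%type.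
Local Notation ks := (@ksubset m k).
Local Notation ks0 := (@ksubset_neq0 m k k_bounds).
Local Notation row0 := (row_neq0 n_gt0).
Implicit Types (v z : idx -> R) (i : 'I_n) (S : {set 'I_m}).

Definition subset_weight v i S := gibbs ks (fun S => b2 * set_sum v i S) S.
Definition row_weight v i := gibbs predT (fun i => - (b1 * smooth_top k b2 v i)) i.
Definition entry_weight v i j := \sum_(S | ks S && (j \in S)) subset_weight v i S.
Definition pair_weight v i j l :=
  \sum_(S | ks S && ((j \in S) && (l \in S))) subset_weight v i S.

Local Notation r := subset_weight.
Local Notation p := row_weight.
Local Notation q := entry_weight.
Local Notation q2 := pair_weight.

Lemma row_weight_ge0 v i : 0 <= p v i. Proof. exact: (gibbs_ge0 row0). Qed.
Lemma sum_row_weight v : \sum_i p v i = 1. Proof. exact: (sum_gibbs row0). Qed.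
Lemma subset_weight_ge0 v i S : 0 <= r v i S. Proof. exact: (gibbs_ge0 ks0). Qed.
Lemma sum_subset_weight v i : \sum_(S | ks S) r v i S = 1.
Proof. exact: (sum_gibbs ks0). Qed.
Lemma entry_weight_ge0 v i j : 0 <= q v i j.
Proof. by apply: sumr_ge0 => S _; exact: subset_weight_ge0. Qed.

Lemma weighted_set_sum v i z :
  \sum_(S | ks S) r v i S * set_sum z i S = \sum_j q v i j * z (i, j).
Proof.
under eq_bigr do rewrite /set_sum big_mkcond mulr_sumr.
rewrite exchange_big/=; apply: eq_bigr => j _.
rewrite /q big_mkcondr/= mulr_suml; apply: eq_bigr => S _.
by case: ifP => _; rewrite ?mulr0 ?mul0r.
Qed.

Lemma weighted_set_sum_sqr v i z :
  \sum_(S | ks S) r v i S * set_sum z i S ^+ 2 =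
  \sum_j \sum_l q2 v i j l * (z (i, j) * z (i, l)).
Proof.
have E S : set_sum z i S ^+ 2 =
    \sum_j \sum_l ((j \in S) && (l \in S))%:R * (z (i, j) * z (i, l)).
  rewrite expr2 /set_sum mulr_suml [LHS]big_mkcond/=; apply: eq_bigr => j _.
  case: ifP => jS /=; last by rewrite big1// => l _; rewrite mul0r.
  rewrite mulr_sumr [LHS]big_mkcond/=; apply: eq_bigr => l _.
  by case: ifP => lS /=; rewrite ?mul1r ?mul0r.
under eq_bigr do rewrite E mulr_sumr.
rewrite exchange_big/=; apply: eq_bigr => j _.
under eq_bigr do rewrite mulr_sumr.
rewrite exchange_big/=; apply: eq_bigr => l _.
rewrite /q2 big_mkcondr/= mulr_suml; apply: eq_bigr => S _.
by case: ifP => _; rewrite ?mul1r ?mul0r ?mulr0.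
Qed.

Lemma sum_entry_weight v i : \sum_j q v i j = k%:R.
Proof.
have := weighted_set_sum v i (fun=> 1); under [RHS]eq_bigr do rewrite mulr1.
move=> <-; rewrite -[RHS]mul1r -(sum_subset_weight v i) mulr_suml.
by apply: eq_bigr => S /eqP Sk; rewrite /set_sum sumr_const Sk.
Qed.

Lemma sum_pair_weight v i j : \sum_l q2 v i j l = k%:R * q v i j.
Proof.
rewrite /q2; under eq_bigr do under eq_bigl do rewrite andbA.
under eq_bigr do rewrite big_mkcondr/=.
rewrite exchange_big/= mulr_sumr; apply: eq_bigr => S /andP[/eqP Sk _].
by rewrite -big_mkcond/= sumr_const Sk mulr_natl.
Qed.

Lemma pair_weightC v i j l : q2 v i j l = q2 v i l j.
Proof. by apply: eq_bigl => S; congr (_ && _); exact: andbC. Qed.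

Lemma pair_weight_diag v i j : q2 v i j j = q v i j.
Proof. by apply: eq_bigl => S; rewrite andbb. Qed.

(** The covariance of two inclusion events equals that of the complementary events
   of avoidance. *)
Lemma pair_weight_neg v i j l : j != l -> q2 v i j l <= q v i j * q v i l.
Proof.
move=> jl; pose w j := expR (b2 * v (i, j)).
pose Z := \sum_(S | ks S) \prod_(j in S) w j.
have W S : expR (b2 * set_sum v i S) = \prod_(j in S) w j.
  by rewrite /set_sum mulr_sumr expR_sum.
have rE S : r v i S = (\prod_(j in S) w j) / Z.
  by rewrite /r /gibbs W; congr (_ / _); apply: eq_bigr => S' _; rewrite W.
have Z0 : 0 < Z.
  by have := expsum_gt0 ks0 (fun S => b2 * set_sum v i S); under eq_bigr do rewrite W.
pose A := \sum_(S : {set 'I_m} | (#|S| == k) && (j \notin S)) \prod_(i in S) w i.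
pose B := \sum_(S : {set 'I_m} | (#|S| == k) && (l \notin S)) \prod_(i in S) w i.
pose N := \sum_(S : {set 'I_m} | (#|S| == k) && ((j \notin S) && (l \notin S)))
  \prod_(i in S) w i.
have NZ : N * Z <= A * B.
  exact: (avoid_negatively_correlated k (w := w) (fun j => expR_ge0 _) jl).
have avoid (x : 'I_m) : q v i x = 1 - (\sum_(S : {set 'I_m} | (#|S| == k) && (x \notin S)) \prod_(i in S) w i) / Z.
  apply: (@addIr _ ((\sum_(S : {set 'I_m} | (#|S| == k) && (x \notin S))
    \prod_(i in S) w i) / Z)).
  rewrite subrK -[RHS](sum_subset_weight v i) [RHS](bigID (fun S => x \in S))/=.
  by rewrite mulr_suml; congr (_ + _); apply: eq_bigr => S _; rewrite rE.
have avoid2 : q2 v i j l = q v i j - B / Z + N / Z.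
  rewrite /q (bigID (fun S => l \in S))/= -/(q2 v i j l).
  have -> : q2 v i j l = \sum_(S | ks S && (j \in S) && (l \in S)) r v i S.
    by apply: eq_bigl => S; rewrite andbA.
  have -> : B / Z = \sum_(S | ks S && (j \in S) && (l \notin S)) r v i S + N / Z.
    rewrite /B (bigID (fun S => j \in S))/= mulrDl; congr (_ + _ / _).
      rewrite mulr_suml; apply: eq_big => S; first by rewrite andbAC.
      by rewrite rE.
    by apply: eq_bigl => S; rewrite -andbA (andbC (l \notin S)).
  ring.
rewrite avoid2 !avoid -/A -/B.
have -> : 1 - A / Z - B / Z + N / Z = 1 - A / Z - B / Z + (N * Z) / (Z * Z).
  by field; rewrite gt_eqF.
have -> : (1 - A / Z) * (1 - B / Z) = 1 - A / Z - B / Z + (A * B) / (Z * Z).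
  by field; rewrite gt_eqF.
by rewrite lerD2l ler_wpM2r// invr_ge0 mulr_ge0// ltW.
Qed.

Definition smooth_hessian v := gibbs_hessian (p v) (q v) (q2 v) b1 b2.

(** Expand along the segment from [v] to [v + z]: [g1] and [g2] are the first two
   derivatives of the smoothed top sums, [f1] and [f2] those of the whole
   functional, and the Lipschitz constant of [f2] is
   [6 (b1 + b2) ^ 2 (sum of the |z a|) ^ 3]. *)
Lemma smooth_min_top_taylor v z :
  `|smooth_min_top k b1 b2 (fun a => v a + z a) - smooth_min_top k b1 b2 v
    - \sum_a p v a.1 * q v a.1 a.2 * z a
    + 4^-1 * \sum_a \sum_b smooth_hessian v a b * (z a - z b) ^+ 2|
  <= 6 * (b1 + b2) ^+ 2 * (\sum_a `|z a|) ^+ 3.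
Proof.
pose x (s : R) : idx -> R := fun a => v a + s * z a.
pose rho := \sum_a `|z a|.
pose zeta i S := set_sum z i S.
have rho0 : 0 <= rho by exact: sumr_ge0.
have zeta_le i S : `|zeta i S| <= rho.
  apply: (le_trans (ler_norm_sum _ _ _)).
  have -> : rho = \sum_i0 \sum_j `|z (i0, j)|.
    by rewrite pair_bigA; apply: eq_bigr => -[].
  rewrite (bigD1 i)//= ler_wpDr//.
    by apply: sumr_ge0 => l _; exact: sumr_ge0.
  by rewrite [leRHS](bigID (mem S))/= lerDl sumr_ge0.
have dsum i S (s : R) : is_derive s 1 (fun s => b2 * set_sum (x s) i S) (b2 * zeta i S).
  rewrite (_ : (fun s => _) = fun s => b2 * (set_sum v i S + s * zeta i S)); last first.
    by apply/funext => t; rewrite /set_sum /x big_split/= -mulr_sumr.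
  by apply: is_derive_eq; rewrite /GRing.scale/=; ring.
pose g1 i s := \sum_(S | ks S) r (x s) i S * zeta i S.
pose g2 i s := b2 * (\sum_(S | ks S) r (x s) i S * zeta i S ^+ 2 - g1 i s ^+ 2).
have dtop i (s : R) : is_derive s 1 (fun s => smooth_top k b2 (x s) i) (g1 i s).
  have h := is_derive_lse ks0 (u := fun S s => b2 * set_sum (x s) i S) (dsum i) s.
  rewrite /smooth_top; apply: is_derive_eq; rewrite /GRing.scale/= mulr_sumr.
  by apply: eq_bigr => S _; rewrite mulrCA mulKf ?gt_eqF.
have dg1 i (s : R) : is_derive s 1 (g1 i) (g2 i s).
  have h := is_derive_gibbs_avg ks0 (u := fun S s => b2 * set_sum (x s) i S) (dsum i)
    (v := fun S _ => zeta i S) (dv := fun _ _ => 0) (s := s) (fun S => is_derive_cst _ _ _).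
  apply: (is_derive_eq h); rewrite big1 ?add0r; last by move=> S _; rewrite mulr0.
  rewrite /g2 mulrBr; congr (_ - _).
    by rewrite mulr_sumr; apply: eq_bigr => S _; rewrite /r; ring.
  rewrite /g1 expr2 mulrA; congr (_ * _); rewrite mulr_sumr.
  by apply: eq_bigr => S _; rewrite /r mulrCA.
pose f1 s := \sum_i p (x s) i * g1 i s.
pose f2 s := \sum_i p (x s) i * g2 i s +
  (- b1) * (\sum_i p (x s) i * g1 i s ^+ 2 + (-1) * f1 s ^+ 2).
have dU i (s : R) : is_derive s 1 (fun s => - (b1 * smooth_top k b2 (x s) i)) (- (b1 * g1 i s)).
  have h := dtop i s; apply: is_derive_eq; by rewrite /GRing.scale/=.
have df (s : R) : is_derive s 1 (fun s => smooth_min_top k b1 b2 (x s)) (f1 s).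
  have h := is_derive_lse row0 (u := fun i s => - (b1 * smooth_top k b2 (x s) i)) dU s.
  rewrite /smooth_min_top; apply: is_derive_eq; rewrite /GRing.scale/= mulr_sumr -sumrN.
  by apply: eq_bigr => i _; rewrite -/(p (x s) i); field; rewrite gt_eqF.
have df1 (s : R) : is_derive s 1 f1 (f2 s).
  have h := is_derive_gibbs_avg row0 (u := fun i s => - (b1 * smooth_top k b2 (x s) i)) dU
    (v := g1) (dv := g2) (s := s) (fun i => dg1 i s).
  apply: (is_derive_eq h); rewrite /f2; congr (_ + _).
  rewrite mulrDr; congr (_ + _).
    by rewrite mulr_sumr; apply: eq_bigr => i _; rewrite -/(p (x s) i); ring.
  have -> : \sum_i gibbs predT (fun i => - (b1 * smooth_top k b2 (x s) i)) i * - (b1 * g1 i s) =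
     - b1 * f1 s.
    by rewrite /f1 mulr_sumr; apply: eq_bigr => i _; rewrite -/(p (x s) i); ring.
  rewrite -/(f1 s); ring.
have bz i S : bounded_deriv rho 0 (fun=> zeta i S).
  split=> [_|]; first exact: zeta_le.
  by exists (fun=> 0) => s; split; [exact: is_derive_cst|rewrite normr0].
have bz2 i S : bounded_deriv (rho ^+ 2) 0 (fun=> zeta i S ^+ 2).
  split=> [_|]; first by rewrite normrX lerXn2r ?nnegrE.
  by exists (fun=> 0) => s; split; [exact: is_derive_cst|rewrite normr0].
have du2 i S : ks S -> forall s : R, `|b2 * zeta i S| <= b2 * rho.
  by move=> _ _; rewrite normrM (gtr0_norm b2_gt0) ler_wpM2l// ltW.
have bg1 i : bounded_deriv rho (2 * (b2 * rho) * rho + 0) (g1 i).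
  exact: (bounded_deriv_gibbs_avg ks0 (u := fun S s => b2 * set_sum (x s) i S)
    (dsum i) (du2 i) (bz i)).
have bs2 i : bounded_deriv (rho ^+ 2) (2 * (b2 * rho) * rho ^+ 2 + 0)
    (fun s => \sum_(S | ks S) r (x s) i S * zeta i S ^+ 2).
  exact: (bounded_deriv_gibbs_avg ks0 (u := fun S s => b2 * set_sum (x s) i S)
    (dsum i) (du2 i) (bz2 i)).
have bg2 i := bounded_derivZ b2 (bounded_derivD (bs2 i) (bounded_derivZ (-1) (bounded_deriv_sqr (bg1 i)))).
have bg2' i : bounded_deriv (2 * b2 * rho ^+ 2) (6 * b2 ^+ 2 * rho ^+ 3) (g2 i).
  have := bg2 i; rewrite (gtr0_norm b2_gt0) normrN1.
  have -> : (fun s => b2 * (\sum_(S | ks S) r (x s) i S * zeta i S ^+ 2 + -1 * g1 i s ^+ 2)) = g2 i.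
    by apply/funext => s; rewrite /g2 mulN1r.
  by congr bounded_deriv; ring.
have du1 i : predT i -> forall s, `|- (b1 * g1 i s)| <= b1 * rho.
  move=> _ s; rewrite normrN normrM (gtr0_norm b1_gt0) ler_wpM2l ?(ltW b1_gt0)//.
  by have [h _] := bg1 i.
have avg := bounded_deriv_gibbs_avg row0
   (u := fun i s => - (b1 * smooth_top k b2 (x s) i)) dU du1.
have bf1 : bounded_deriv rho (2 * (b1 * rho) * rho + (2 * (b2 * rho) * rho + 0)) f1.
  exact: (avg _ _ _ bg1).
have bf2 := bounded_derivD (avg _ _ _ bg2') (bounded_derivZ (- b1)
  (bounded_derivD (avg _ _ _ (fun i => bounded_deriv_sqr (bg1 i)))
    (bounded_derivZ (-1) (bounded_deriv_sqr bf1)))).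
have x0 : x 0 = v by apply/funext => a; rewrite /x mul0r addr0.
have x1 : x 1 = fun a => v a + z a by apply/funext => a; rewrite /x mul1r.
have := taylor_bound df df1 bf2; rewrite x0 x1.
have f10 : f1 0 = \sum_a p v a.1 * q v a.1 a.2 * z a.
  rewrite /f1 x0 /g1 x0.
  under eq_bigr do rewrite weighted_set_sum mulr_sumr.
  by rewrite pair_bigA; apply: eq_bigr => -[i j] _; rewrite /= mulrA.
have f20 : f2 0 = - (2^-1 * \sum_a \sum_b smooth_hessian v a b * (z a - z b) ^+ 2).
  rewrite -quadratic_increments; last first.
  - move=> b; exact: (gibbs_hessian_col b1 b2 (sum_row_weight v) (sum_entry_weight v)
      (pair_weightC v) (sum_pair_weight v)).
  - move=> a; exact: (gibbs_hessian_row b1 b2 (sum_row_weight v) (sum_entry_weight v)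
      (sum_pair_weight v)).
  rewrite (gibbs_hessian_quad (p v) (q v) (q2 v) b1 b2).
  have e1 i : g1 i 0 = \sum_j q v i j * z (i, j) by rewrite /g1 x0 weighted_set_sum.
  have e2 i : g2 i 0 = b2 * (\sum_j \sum_l q2 v i j l * (z (i, j) * z (i, l))
      - (\sum_j q v i j * z (i, j)) ^+ 2).
    by rewrite /g2 e1 x0 weighted_set_sum_sqr.
  rewrite /f2 /f1 x0 (eq_bigr _ (fun i _ => congr1 ( *%R (p v i)) (e2 i))).
  rewrite (eq_bigr _ (fun i _ => congr1 (fun y => p v i * y ^+ 2) (e1 i))).
  rewrite (eq_bigr _ (fun i _ => congr1 ( *%R (p v i)) (e1 i))); ring.
rewrite f10 f20 normrN (gtr0_norm b1_gt0) normrN1 -/rho.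
set LHS := `|_|; set RHS := (X in _ <= X -> _).
have -> : RHS = 6 * (b1 + b2) ^+ 2 * rho ^+ 3 by rewrite /RHS; ring.
apply: le_trans; rewrite /LHS le_eqVlt; apply/orP; left; apply/eqP; congr `|_|.
have -> : 4^-1 = 2^-1 * 2^-1 :> R by field.
by congr (_ + _); rewrite -mulrA mulrN opprK.
Qed.

End smoothing_weights.

(** * The comparison theorem *)

Lemma sum_norm_cube (R : realFieldType) (J : finType) (z : J -> R) :
  (\sum_a `|z a|) ^+ 3 <= #|J|%:R ^+ 3 * \sum_a `|z a| ^+ 3.
Proof.
have [/card0_eq J0|/card_gt0P[a0 _]] := posnP #|J|.
  rewrite !big1 ?mulr0 ?expr0n// => a; by have := J0 a; rewrite inE.
pose b := [arg max_(a > a0) `|z a|]%O.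
have zb a : `|z a| <= `|z b|.
  by rewrite /b; case: arg_maxP => // c _; apply.
have h : \sum_a `|z a| <= #|J|%:R * `|z b|.
  rewrite mulr_natl -sumr_const; apply: ler_sum => a _; exact: zb.
apply: (@le_trans _ _ ((#|J|%:R * `|z b|) ^+ 3)).
  by rewrite lerXn2r ?nnegrE ?mulr_ge0 ?sumr_ge0.
rewrite exprMn ler_wpM2l ?exprn_ge0// (bigD1 b)//= lerDl.
by apply: sumr_ge0 => a _; rewrite exprn_ge0.
Qed.

(** The minimum of [a * b + c / b] is at [b = sqrt (c / a)]; when [a] or [c] vanishes
   the infimum is only approached, hence the slack [e]. *)
Lemma optimise_parameter (R : realType) (a c x y : R) : 0 <= a -> 0 <= c ->
  (forall b, 0 < b -> x <= a * b + c / b + y) -> x <= 2 * Num.sqrt (a * c) + y.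
Proof.
move=> a0 c0 h; apply/ler_addgt0Pr => e e0.
have [a_eq0|a_neq0] := eqVneq a 0.
  rewrite a_eq0 mul0r sqrtr0 mulr0 add0r.
  have b0 : 0 < (c + 1) / e by rewrite divr_gt0// ltr_wpDl.
  apply: (le_trans (h _ b0)); rewrite a_eq0 mul0r add0r addrC lerD2l.
  rewrite invf_div mulrA ler_pdivrMr ?ltr_wpDl//.
  by rewrite mulrDr mulr1 mulrC lerDl ltW.
have a_gt0 : 0 < a by rewrite lt_neqAle eq_sym a_neq0.
have [c_eq0|c_neq0] := eqVneq c 0.
  rewrite c_eq0 mulr0 sqrtr0 mulr0 add0r.
  have b0 : 0 < e / a by rewrite divr_gt0.
  apply: (le_trans (h _ b0)); rewrite c_eq0 mul0r addr0 mulrC divfK// addrC//.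
have c_gt0 : 0 < c by rewrite lt_neqAle eq_sym c_neq0.
have b0 : 0 < Num.sqrt (c / a) by rewrite sqrtr_gt0 divr_gt0.
apply: (le_trans (h _ b0)).
set b := Num.sqrt (c / a).
have E1 : a * b = Num.sqrt (a * c).
  rewrite -[a in LHS]ger0_norm// -sqrtr_sqr -sqrtrM ?sqr_ge0//.
  by congr Num.sqrt; field.
have E2 : c / b = Num.sqrt (a * c).
  apply: (canLR (mulfK (lt0r_neq0 b0))).
  rewrite -sqrtrM ?mulr_ge0// -[LHS]ger0_norm// -sqrtr_sqr.
  by congr Num.sqrt; field.
rewrite E1 E2. have -> : 2 * Num.sqrt (a * c) = Num.sqrt (a * c) + Num.sqrt (a * c) by ring.
by rewrite lerDl ltW.
Qed.

Section min_top_comparison.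
Context (R : realType) (n m k : nat) d (T : measurableType d) (P : probability T R).
Hypotheses (n_gt0 : (0 < n)%N) (k_bounds : (1 <= k <= m)%N).
Local Notation idx := ('I_n * 'I_m)%type.
Local Notation emt := (@exact_min_top R n m k n_gt0).

Lemma cvg_inv_nat (c : R) : c / N.+1%:R @[N --> \oo] --> 0.
Proof.
rewrite -(mulr0 c); apply: cvgM; first exact: cvg_cst.
exact: cvg_harmonic.
Qed.

Lemma exact_smooth_dist b1 b2 (v : idx -> R) : 0 < b1 -> 0 < b2 ->
  `|smooth_min_top k b1 b2 v - emt v| <= ln n%:R / b1 + ln ('C(m, k))%:R / b2.
Proof.
move=> b10 b20.
have := smooth_min_top_ge n_gt0 k_bounds b10 b20 v.
have := smooth_min_top_le n_gt0 k_bounds b10 b20 v.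
have h1 : 0 <= ln n%:R / b1 by rewrite divr_ge0 ?lnN_ge0// ltW.
have h2 : 0 <= ln ('C(m, k))%:R / b2 by rewrite divr_ge0 ?lnN_ge0// ltW.
by rewrite ler_norml; lra.
Qed.

(** A pointwise limit of its smooth approximations. *)
Lemma measurable_exact_min_top : measurable_fun [set: rvec R idx] emt.
Proof.
apply: (@measurable_fun_cvg _ _ _ _
  (fun (N : nat) => smooth_min_top k N.+1%:R N.+1%:R : rvec R idx -> R)).
  by move=> N; exact: measurable_smooth_min_top.
move=> v _; apply: cvg_zero; apply: norm_cvg0.
apply: (@squeeze_cvgr _ _ _ _ (cst 0)
  (fun N : nat => (ln n%:R + ln ('C(m, k))%:R) / N.+1%:R)).
- apply: nearW => N; rewrite normr_ge0 mulrDl/=.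
  by have := @exact_smooth_dist N.+1%:R N.+1%:R v (ltr0Sn _ _) (ltr0Sn _ _).
- exact: cvg_cst.
- exact: cvg_inv_nat.
Qed.

Lemma rint_exact_min_top (X : idx -> T -> R) :
  (forall a, P.-integrable [set: T] (EFin \o X a)) ->
  P.-integrable [set: T] (EFin \o (fun w => emt (X^~ w))).
Proof.
move=> iX; apply: (@rint_le _ _ _ _ _ (fun w => \sum_a `|X a w|)).
- apply: (measurableT_comp measurable_exact_min_top).
  by apply: measurable_rvec => a; exact: (rint_measurable (iX a)).
- by move=> w; exact: exact_min_top_growth.
- by apply: rint_sum => a; exact: rint_norm.
Qed.

Lemma min_top_comparison (x y : idx -> T -> R) (mu : idx -> R) (b1 b2 K : R) :
  centered_gaussian P x -> centered_gaussian P y -> 0 < b1 -> 0 < b2 ->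
  (forall v, 4^-1 * \sum_a \sum_b smooth_hessian k b1 b2 v a b *
    (\int[P]_w (y a w - y b w) ^+ 2 - \int[P]_w (x a w - x b w) ^+ 2) <= K) ->
  \int[P]_w emt (fun a => mu a + x a w) - \int[P]_w emt (fun a => mu a + y a w) <=
  K + ln n%:R / b1 + ln ('C(m, k))%:R / b2.
Proof.
have arith (a c e f u w : R) : a <= c + u -> f <= e + w -> c - f <= K ->
  a - e <= K + u + w by lra.
move=> gx gy b10 b20 hK.
have grow := smooth_min_top_growth n_gt0 k_bounds b10 b20.
have mF := @measurable_smooth_min_top R n m k b1 b2.
have C0 : 0 <= 6 * (b1 + b2) ^+ 2 * #|{: idx}|%:R ^+ 3.
  by apply: mulr_ge0; [apply: mulr_ge0 => //; exact: sqr_ge0|exact: exprn_ge0].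
have comp := gaussian_comparison gx gy mu mF grow
  (g := fun v a => row_weight k b1 b2 v a.1 * entry_weight k b2 v a.1 a.2)
  (M := smooth_hessian k b1 b2) C0 _ hK.
have int_mu (u : idx -> T -> R) a : centered_gaussian P u ->
    P.-integrable [set: T] (EFin \o (fun w => mu a + u a w)).
  move=> gu; apply: rintD; first exact: rint_cst.
  exact: centered_gaussian_int.
have iS (u : idx -> T -> R) : centered_gaussian P u ->
    P.-integrable [set: T] (EFin \o (fun w => smooth_min_top k b1 b2 (fun a => mu a + u a w))).
  move=> gu; apply: (growth_int mF grow (U := fun a w => mu a + u a w)) => a.
  exact: int_mu.
have iE (u : idx -> T -> R) : centered_gaussian P u ->
    P.-integrable [set: T] (EFin \o (fun w => emt (fun a => mu a + u a w))).
  by move=> gu; apply: (rint_exact_min_top (X := fun a w => mu a + u a w)) => a; exact: int_mu.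
have up : \int[P]_w emt (fun a => mu a + x a w) <=
    \int[P]_w smooth_min_top k b1 b2 (fun a => mu a + x a w) + ln n%:R / b1.
  rewrite -[X in _ + X](@Rint_cst _ _ _ P) -RintD; [|exact: iS|exact: rint_cst].
  apply: Rint_le; [exact: iE|by apply: rintD; [exact: iS|exact: rint_cst]|move=> w].
  by rewrite -lerBlDr; exact: (smooth_min_top_ge n_gt0 k_bounds b10 b20).
have low : \int[P]_w smooth_min_top k b1 b2 (fun a => mu a + y a w) <=
    \int[P]_w emt (fun a => mu a + y a w) + ln ('C(m, k))%:R / b2.
  rewrite -[X in _ + X](@Rint_cst _ _ _ P) -RintD; [|exact: iE|exact: rint_cst].
  apply: Rint_le; [exact: iS|by apply: rintD; [exact: iE|exact: rint_cst]|move=> w].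
  exact: (smooth_min_top_le n_gt0 k_bounds b10 b20).
apply: (arith _ _ _ _ _ _ up low).
apply: comp => v z.
apply: (le_trans (smooth_min_top_taylor n_gt0 k_bounds b10 b20 v z)).
rewrite -[leRHS]mulrA; apply: ler_wpM2l; last exact: sum_norm_cube.
by apply: mulr_ge0 => //; exact: sqr_ge0.
Qed.

End min_top_comparison.

Section gaussian_matrices.
Context (R : realType) (n m : nat) d (T : measurableType d) (P : probability T R).
Local Notation idx := ('I_n * 'I_m)%type.
Implicit Type X : 'I_n -> 'I_m -> {RV P >-> R}.

Definition mean X (a : idx) := \int[P]_w X a.1 a.2 w.
Definition centered X (a : idx) (w : T) := X a.1 a.2 w - mean X a.

Let mX X (a : idx) : measurable_fun [set: T] (X a.1 a.2 : T -> R).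
Proof. exact: measurable_funPT. Qed.

Lemma gaussian_matrix_centered X : gaussian_matrix X ->
  (forall a : idx, P.-integrable [set: T] (EFin \o (X a.1 a.2 : T -> R))) /\
  centered_gaussian P (centered X).
Proof.
move=> gX; apply: (gaussian_centered (X := fun a : idx => X a.1 a.2)) => [a|a].
  exact: mX.
have := gX (\matrix_(i, j) a (i, j)); congr is_gaussian; apply/funext => w.
rewrite pair_bigA; apply: eq_bigr => -[i j] _.
by rewrite mxE.
Qed.

(** The means contribute the same square to the increments of two families with
   equal means. *)
Lemma incr_centered X (a b : idx) : gaussian_matrix X ->
  incr X a.1 a.2 b.1 b.2 =
  \int[P]_w (centered X a w - centered X b w) ^+ 2 + (mean X a - mean X b) ^+ 2.
Proof.
move=> gX; have [_ gc] := gaussian_matrix_centered gX.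
have ic c : P.-integrable [set: T] (EFin \o centered X c) by exact: centered_gaussian_int.
have i0 c : \int[P]_w centered X c w = 0 by have [_ _ + _] := gc; exact.
rewrite /incr unlock.
pose del := mean X a - mean X b.
transitivity (\int[P]_w ((centered X a w - centered X b w) ^+ 2 +
    (2 * del * (centered X a w - centered X b w) + del ^+ 2))).
  by apply: eq_Rintegral => w _; rewrite /centered /del; ring.
have i1 : P.-integrable [set: T] (EFin \o (fun w => centered X a w - centered X b w)).
  exact: rintB.
have i2 := rintZ (2 * del) i1.
have i3 := rint_cst P (del ^+ 2).
rewrite RintD; [|exact: centered_gaussian_sqr|exact: rintD].
by rewrite RintD// RintZ// RintB// !i0 subrr mulr0 add0r Rint_cst.
Qed.

Lemma expectation_min_top (n_gt0 : (0 < n)%N) (k : nat) X : (1 <= k <= m)%N ->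
  gaussian_matrix X -> 'E_P[min_top_sum n_gt0 k X]%E =
  (\int[P]_w exact_min_top k n_gt0 (fun a : idx => mean X a + centered X a w))%:E.
Proof.
move=> kb gX; have [iX _] := gaussian_matrix_centered gX.
have E w : (fun a : idx => mean X a + centered X a w) = fun a => X a.1 a.2 w.
  by apply/funext => a; rewrite /centered subrKC.
under [in RHS]eq_Rintegral do rewrite E.
rewrite -Rint_EFin; last exact: (rint_exact_min_top n_gt0 kb iX).
by rewrite unlock.
Qed.

Lemma incr_dist_ge X Y (a b : idx) :
  `|incr X a.1 a.2 b.1 b.2 - incr Y a.1 a.2 b.1 b.2| <= incr_dist X Y.
Proof.
rewrite /incr_dist.
apply: le_trans (le_bigmax _ _ a.1); apply: le_trans (le_bigmax _ _ a.2).
by apply: le_trans (le_bigmax _ _ b.1); exact: (le_bigmax _ _ b.2).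
Qed.

End gaussian_matrices.

Lemma sqrt_quarter (R : realType) (s t : R) : 0 <= s ->
  2 * Num.sqrt (4^-1 * (s * t)) = Num.sqrt s * Num.sqrt t.
Proof.
move=> s0; have -> : 4^-1 = 2^-1 ^+ 2 :> R by field.
rewrite sqrtrM ?sqr_ge0// sqrtr_sqr ger0_norm ?invr_ge0// mulrA divff// mul1r.
by rewrite sqrtrM.
Qed.

(** Both conclusions are the smoothed comparison with a different bound on the
   second-order term, followed by the optimisation of [b1] and then of [b2]. *)
Lemma min_top_sum_bound (R : realType) (n m : nat) d (T : measurableType d)
  (P : probability T R) (n_gt0 : (0 < n)%N) (m_gt0 : (0 < m)%N) (k : nat)
  (X Y : 'I_n -> 'I_m -> {RV P >-> R}) :
  (1 <= k <= m)%N -> gaussian_matrix X -> gaussian_matrix Y ->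
  (forall a, mean X a = mean Y a) ->
  let D := \int[P]_w exact_min_top k n_gt0 (fun a => mean X a + centered X a w) -
           \int[P]_w exact_min_top k n_gt0 (fun a => mean Y a + centered Y a w) in
  D <= Num.sqrt (incr_dist X Y * k%:R) *
       (Num.sqrt (k%:R * (1 - 1 / n%:R) * (2 - 1 / m%:R) * ln n%:R) +
        Num.sqrt ((1 - k%:R / m%:R) * ln ('C(m, k))%:R)) /\
  ((forall (i1 : 'I_n) (i2 : 'I_m) (j1 : 'I_n) (j2 : 'I_m),
      (i1 = j1 -> incr X i1 i2 j1 j2 <= incr Y i1 i2 j1 j2) /\
      (i1 <> j1 -> incr X i1 i2 j1 j2 >= incr Y i1 i2 j1 j2)) -> D <= 0).
Proof.
move=> kb gX gY meanXY D.
have [_ cX] := gaussian_matrix_centered gX.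
have [_ cY] := gaussian_matrix_centered gY.
pose De a b := \int[P]_w (centered Y a w - centered Y b w) ^+ 2 -
               \int[P]_w (centered X a w - centered X b w) ^+ 2.
have DeE a b : De a b = incr Y a.1 a.2 b.1 b.2 - incr X a.1 a.2 b.1 b.2.
  have shift (u v w : R) : u - v = u + w - (v + w) by ring.
  rewrite (incr_centered a b gY) (incr_centered a b gX) !meanXY; exact: shift.
have De0 a : De a a = 0.
  have z0 Z : \int[P]_w (centered Z a w - centered Z a w) ^+ 2 = 0.
    by under eq_Rintegral do rewrite subrr expr0n/=; exact: Rint_cst.
  by rewrite /De !z0 subrr.
have compare b1 b2 K : 0 < b1 -> 0 < b2 ->
    (forall v, 4^-1 * \sum_a \sum_b smooth_hessian k b1 b2 v a b * De a b <= K) ->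
    D <= K + ln n%:R / b1 + ln ('C(m, k))%:R / b2.
  move=> b10 b20 hK.
  have -> : D = \int[P]_w exact_min_top k n_gt0 (fun a => mean X a + centered X a w) -
      \int[P]_w exact_min_top k n_gt0 (fun a => mean X a + centered Y a w).
    by rewrite /D (funext meanXY).
  exact: (min_top_comparison n_gt0 kb (mean X) cX cY b10 b20 hK).
have lnn := lnN_ge0 R n; have lnC := lnN_ge0 R 'C(m, k).
split.
- set g := incr_dist X Y.
  have g0 : 0 <= g.
    exact: le_trans (normr_ge0 _) (incr_dist_ge X Y (Ordinal n_gt0, Ordinal m_gt0) (Ordinal n_gt0, Ordinal m_gt0)).
  have n1 : 1 / n%:R <= 1 :> R by rewrite ler_pdivrMr ?ltr0n// mul1r ler1n.
  have m1 : 1 / m%:R <= 1 :> R by rewrite ler_pdivrMr ?ltr0n// mul1r ler1n.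
  have km : k%:R / m%:R <= 1 :> R.
    by rewrite ler_pdivrMr ?ltr0n// mul1r ler_nat; have /andP[] := kb.
  pose A := k%:R * (1 - 1 / n%:R) * (2 - 1 / m%:R) : R.
  pose B := 1 - k%:R / m%:R : R.
  have A0 : 0 <= A by rewrite !mulr_ge0// subr_ge0// (le_trans m1)// ler1n.
  have B0 : 0 <= B by rewrite subr_ge0.
  have gk0 : 0 <= g * k%:R by rewrite mulr_ge0.
  have bound b1 b2 : 0 < b1 -> 0 < b2 ->
      D <= 4^-1 * (g * k%:R * A) * b1 + ln n%:R / b1 +
           (4^-1 * (g * k%:R * B) * b2 + ln ('C(m, k))%:R / b2).
    move=> b10 b20.
    have := @compare b1 b2 (4^-1 * (g * (b1 * (k%:R * A) + b2 * (k%:R * B)))) b10 b20.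
    have -> : 4^-1 * (g * (b1 * (k%:R * A) + b2 * (k%:R * B))) + ln n%:R / b1 + ln ('C(m, k))%:R / b2 =
      4^-1 * (g * k%:R * A) * b1 + ln n%:R / b1 + (4^-1 * (g * k%:R * B) * b2 + ln ('C(m, k))%:R / b2) by ring.
    apply => v; rewrite ler_wpM2l ?invr_ge0//.
    apply: (gibbs_hessian_offdiag (ltW b10) (ltW b20)) => //.
    + exact: row_weight_ge0.
    + exact: sum_row_weight.
    + exact: entry_weight_ge0.
    + exact: sum_entry_weight.
    + exact: pair_weight_diag.
    + exact: sum_pair_weight.
    + exact: pair_weight_neg.
    + by move=> a b; rewrite DeE distrC; exact: incr_dist_ge.
  have c1 : 0 <= 4^-1 * (g * k%:R * A).
    by apply: mulr_ge0; [rewrite invr_ge0|exact: mulr_ge0].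
  have c2 : 0 <= 4^-1 * (g * k%:R * B).
    by apply: mulr_ge0; [rewrite invr_ge0|exact: mulr_ge0].
  have step b2 : 0 < b2 -> D <= 4^-1 * (g * k%:R * B) * b2 + ln ('C(m, k))%:R / b2 +
      2 * Num.sqrt (4^-1 * (g * k%:R * A) * ln n%:R).
    move=> b20; rewrite [leRHS]addrC; apply: (optimise_parameter c1 lnn) => b1 b10.
    exact: bound.
  have split_sqrt (u t : R) : 2 * Num.sqrt (4^-1 * (g * k%:R * u) * t) =
      Num.sqrt (g * k%:R) * Num.sqrt (u * t).
    by rewrite -(mulrA 4^-1) -(mulrA (g * k%:R)) sqrt_quarter.
  have := optimise_parameter c2 lnC step.
  by rewrite !split_sqrt mulrDr addrC.
- move=> sgn.
  have bound b1 b2 : 0 < b1 -> 0 < b2 ->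
      D <= 0 * b1 + ln n%:R / b1 + (0 * b2 + ln ('C(m, k))%:R / b2).
    move=> b10 b20; have := @compare b1 b2 0 b10 b20.
    rewrite !mul0r !add0r; apply => v.
    rewrite pmulr_rle0 ?invr_gt0//; apply: sumr_le0 => -[i j] _; apply: sumr_le0 => -[i' l] _.
    have [hs hd] := sgn i j i' l; have [ii|/eqP ii] := eqVneq i i'.
      have [jl|jl] := eqVneq j l; first by rewrite ii jl De0 mulr0.
      rewrite mulr_le0_ge0//; last by rewrite DeE subr_ge0 hs.
      rewrite -ii; apply: (gibbs_hessian_same (ltW b10) (ltW b20)) => //.
      + exact: row_weight_ge0.
      + exact: sum_row_weight.
      + exact: entry_weight_ge0.
      + exact: pair_weight_neg.
    rewrite mulr_ge0_le0//; last by rewrite DeE subr_le0 hd.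
    apply: (gibbs_hessian_diff _ _ (ltW b10) (row_weight_ge0 k n_gt0 b1 b2 v)
      (entry_weight_ge0 kb b2 v)); exact/eqP.
  have step b2 : 0 < b2 -> D <= 0 * b2 + ln ('C(m, k))%:R / b2 + 2 * Num.sqrt (0 * ln n%:R).
    move=> b20; rewrite [leRHS]addrC; apply: (optimise_parameter (lexx 0) lnn) => b1 b10.
    exact: bound.
  have := optimise_parameter (lexx 0) lnC step.
  by rewrite !mul0r sqrtr0 mulr0 addr0.
Qed.

Lemma incr_distC (R : realType) (n m : nat) d (T : measurableType d)
  (P : probability T R) (X Y : 'I_n -> 'I_m -> {RV P >-> R}) :
  incr_dist X Y = incr_dist Y X.
Proof. by rewrite /incr_dist; do 4 (apply: eq_bigr => ? _); exact: distrC. Qed.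

Theorem theorem1 (d : measure_display) (T : measurableType d) (R : realType)
  (P : probability T R) (n m : nat) (n_gt0 : (0 < n)%N) (m_gt0 : (0 < m)%N)
  (X Y : 'I_n -> 'I_m -> {RV P >-> R})
  (gaussX : gaussian_matrix X) (gaussY : gaussian_matrix Y)
  (meanXY : forall (i1 : 'I_n) (i2 : 'I_m), 'E_P[X i1 i2]%E = 'E_P[Y i1 i2]%E) :
  (forall k : nat, (1 <= k <= m)%N ->
    (`| 'E_P[min_top_sum n_gt0 k X] - 'E_P[min_top_sum n_gt0 k Y] | <=
     (Num.sqrt (incr_dist X Y * k%:R) *
       (Num.sqrt (k%:R * (1 - 1 / n%:R) * (2 - 1 / m%:R) * ln n%:R) +
        Num.sqrt ((1 - k%:R / m%:R) * ln ('C(m, k))%:R)))%R%:E)%E)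
  /\
  ((forall (i1 : 'I_n) (i2 : 'I_m) (j1 : 'I_n) (j2 : 'I_m),
      (i1 = j1 -> incr X i1 i2 j1 j2 <= incr Y i1 i2 j1 j2) /\
      (i1 <> j1 -> incr X i1 i2 j1 j2 >= incr Y i1 i2 j1 j2)) ->
   forall k : nat, (1 <= k <= m)%N ->
     ('E_P[min_top_sum n_gt0 k X] <= 'E_P[min_top_sum n_gt0 k Y])%E).
Proof.
have mXY a : mean X a = mean Y a.
  by have := meanXY a.1 a.2; rewrite unlock => /(congr1 fine).
split=> [k kb|sgn k kb].
- rewrite (expectation_min_top n_gt0 kb gaussX) (expectation_min_top n_gt0 kb gaussY).
  rewrite -EFinB lee_fin ler_norml.
  have [h1 _] := min_top_sum_bound n_gt0 m_gt0 kb gaussX gaussY mXY.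
  have [h2 _] := min_top_sum_bound n_gt0 m_gt0 kb gaussY gaussX (fun a => esym (mXY a)).
  by rewrite h1 andbT lerNl opprB incr_distC.
- rewrite (expectation_min_top n_gt0 kb gaussX) (expectation_min_top n_gt0 kb gaussY).
  rewrite lee_fin -subr_le0.
  by have [_] := min_top_sum_bound n_gt0 m_gt0 kb gaussX gaussY mXY; apply.
Qed.
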